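(* Let $F\in Gr_1(F_0)$ and $X,Y\in\mathbf{g}_1(F)$, and set $$c_1(X,Y)=-\tfrac14\,\mathrm{str}\big(F_0[F_0,X]_s[F_0,Y]_s\big),\qquad b(X;F)=\tfrac18\,\mathrm{str}\big((F-F_0)F_0[F_0,X]_s\big),$$ $$c_2(X,Y;F)=c_1(X,Y)+(\delta b)(X,Y;F).$$ Then $$c_2(X,Y;F)=\tfrac18\,\mathrm{str}_{\mathrm c}\Big((F-F_0)\big[[F_0,X]_s,[F_0,Y]_s\big]_s\Big).$$ Moreover, the right-hand side exists (i.e. the conditional supertrace is well defined) even for all $F\in Gr_2(F_0)$ and $X,Y\in\mathbf{g}_2(F)$.
   Context: Let $h=h_{\bar 0}\oplus h_{\bar 1}$ be a separable complex $\mathbf{Z}_2$-graded Hilbert space with $h_{\bar0},h_{\bar1}$ both infinite dimensional, $P_\alpha$ the orthogonal projection onto $h_\alpha$, and $\gamma=P_{\bar0}-P_{\bar1}$. Let $\mathcal{B}$ be the algebra of bounded operators on $h$. It is $\mathbf{Z}_2$-graded: an operator mapping $h_\beta$ to $h_\alpha$ (and vanishing on the other summand) has degree $\alpha+\beta$, so even (degree $\bar0$) operators commute with $\gamma$ and odd (degree $\bar1$) ones anticommute with it. The supercommutator is $[A,B]_s=AB-(-1)^{\deg(A)\deg(B)}BA$ for homogeneous $A,B$, extended bilinearly to all of $\mathcal{B}$. All formulas containing sign factors $(-1)^{\deg(X)\deg(Y)}$ are defined for homogeneous $X,Y$ and extended bilinearly in $X,Y$. $\mathcal{B}_{2p}$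 denotes the Schatten ideal of $A\in\mathcal{B}$ with $(A^*A)^p$ trace class; $\mathcal{B}_1$ is the trace class ideal. Fix $F_0\in\mathcal{B}$ with $[F_0,\gamma]=0$ and $F_0=F_0^*=F_0^{-1}$. (As $F_0$ is even, $[F_0,A]_s=F_0A-AF_0$.) For $p=1,2$ define $$Gr_p(F_0)=\{F\in\mathcal{B}: F^2=1,\ F-F_0\in\mathcal{B}_{2p}\},\qquad \mathbf{g}_p(F)=\{X\in\mathcal{B}: [F,X]_s\in\mathcal{B}_{2p}\}.$$ The supertrace is $\mathrm{str}(a)=\mathrm{tr}(\gamma a)$ for $a\in\mathcal{B}_1$. The conditional supertrace is $\mathrm{str}_{\mathrm c}(a)=\frac12\mathrm{tr}\big(\gamma(a+F_0aF_0)\big)$, defined whenever $a+F_0aF_0\in\mathcal{B}_1$. For a function $\zeta(X;F)$, linear in $X$, the coboundary is $$(\delta\zeta)(X,Y;F)=\zeta([X,Y]_s;F)-\mathcal{L}_X\zeta(Y;F)+(-1)^{\deg(X)\deg(Y)}\mathcal{L}_Y\zeta(X;F),$$ where the Lie derivative of a functional $m$ of $F$ is $(\mathcal{L}_Xm)(F)=\frac{d}{dt}m\big(F+t[F,X]_s\big)\big|_{t=0}$. Here, for $m=b(Y;\cdot)$, the functional is understood as given by the same formula on the affine space $F_0+\mathcal{B}_2$. *)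

(* Defs.v *)
(* MathComp-Analysis, over the complex numbers R[i] of an arbitrary R : realType. *)
From HB Require Import structures.
From mathcomp Require Import all_boot all_order all_algebra.
From mathcomp Require Import complex.
From mathcomp Require Import boolp classical_sets functions cardinality reals.
From mathcomp Require Import topology normedtype sequences.

Set Implicit Arguments.
Unset Strict Implicit.
Unset Printing Implicit Defensive.

Import Order.TTheory GRing.Theory Num.Theory.
Import numFieldNormedType.Exports.

Local Open Scope classical_set_scope.
Local Open Scope ring_scope.

Section BoundedOperators.
Context {K : numFieldType} {H : normedModType K}.

Definition bounded_operator (f : H -> H) : Prop :=
  linear f /\ exists2 M : K, 0 <= M & forall x, `|f x| <= M * `|x|.

Definition bounded_pred : {pred H -> H} := fun f => `[< bounded_operator f >].

Record bop := Bop { bop_fun :> H -> H; bopP : bop_fun \in bounded_pred }.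

HB.instance Definition _ := [isSub for bop_fun].
HB.instance Definition _ := [Choice of bop by <:].

Lemma bounded_op0 : (0 : H -> H) \in bounded_pred.
Proof.
apply/asboolP; split; first by move=> a x y; rewrite scaler0 addr0.
by exists 0 => // x; rewrite normr0 mul0r.
Qed.

Lemma bounded_submod : submod_closed bounded_pred.
Proof.
split; first exact: bounded_op0.
move=> a f g /asboolP[fl [M M0 fM]] /asboolP[gl [N N0 gN]]; apply/asboolP; split.
  by move=> b x y; rewrite /= !fctE fl gl !scalerDr !scalerA (mulrC a) addrACA.
exists (`|a| * M + N) => [|x]; first by rewrite addr_ge0// mulr_ge0.
rewrite !fctE mulrDl.
apply: (le_trans (ler_normD _ _)); apply: lerD => //.
by rewrite normrZ -mulrA ler_wpM2l.
Qed.

HB.instance Definition _ :=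
  GRing.isSubmodClosed.Build K (H -> H) bounded_pred bounded_submod.
HB.instance Definition _ := [SubChoice_isSubLmodule of bop by <:].

Lemma bop_linear (A : bop) : linear A.
Proof. by have /asboolP[] := bopP A. Qed.

Lemma bop1_subproof : (idfun : H -> H) \in bounded_pred.
Proof. by apply/asboolP; split=> //; exists 1 => // x; rewrite mul1r. Qed.

Lemma bopM_subproof (A B : bop) : (A \o B) \in bounded_pred.
Proof.
have /asboolP[Al [M M0 AM]] := bopP A; have /asboolP[Bl [N N0 BN]] := bopP B.
apply/asboolP; split; first by move=> a x y; rewrite /= Bl Al.
exists (M * N) => [|x /=]; first by rewrite mulr_ge0.
by rewrite -mulrA; apply: (le_trans (AM _)); rewrite ler_wpM2l.
Qed.

Definition bop1 : bop := Bop bop1_subproof.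
Definition bopM (A B : bop) : bop := Bop (bopM_subproof A B).

Lemma bopMA : associative bopM.
Proof. by move=> A B C; apply: val_inj. Qed.
Lemma bop1M : left_id bop1 bopM.
Proof. by move=> A; apply: val_inj. Qed.
Lemma bopM1 : right_id bop1 bopM.
Proof. by move=> A; apply: val_inj. Qed.
Lemma bopMDl : left_distributive bopM +%R.
Proof. by move=> A B C; apply: val_inj. Qed.
Lemma bopMDr : right_distributive bopM +%R.
Proof.
move=> A B C; apply: val_inj; apply/funext => x /=.
by rewrite !fctE -[B x]scale1r bop_linear !scale1r.
Qed.

(* The product of the ring structure on [bop] is composition. *)
HB.instance Definition _ := GRing.Zmodule_isPzRing.Build bop
  bopMA bop1M bopM1 bopMDl bopMDr.

End BoundedOperators.
Arguments bop {K} H.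

Definition finite_dimensional (K : fieldType) (V : lmodType K) (S : set V) :=
  exists n (v : 'I_n -> V), forall x, S x ->
    exists c : 'I_n -> K, x = \sum_(i < n) c i *: v i.

Definition separable (T : topologicalType) :=
  exists2 D : set T, countable D & dense D.

Section Operators.
Context {R : realType} {H : completeNormedModType R[i]}.
Variable dot : {dot H for Num.conj}.

Definition adjoint (A : bop H) : bop H :=
  xget 0 [set B : bop H | forall x y, dot (A x) y = dot x (B y)].

Definition positive_op (A : bop H) := forall x, 0 <= dot (A x) x.

Definition orthonormal_basis (e : nat -> H) :=
  (forall m n, dot (e m) (e n) = (m == n)%:R) /\
  (forall x, series (fun n => dot x (e n) *: e n) @ \oo --> x).

(* Orthogonal projections onto the summands of h = h_0 (+) h_1; the degrees
   0 and 1 are the booleans false and true. *)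
Definition grading (P : bool -> bop H) :=
  [/\ P false + P true = 1,
      forall a, P a * P a = P a &
      forall a, adjoint (P a) = P a].

Definition summable_diag (e : nat -> H) (A : bop H) :=
  cvgn (series (fun n => dot (A (e n)) (e n) : R[i]^o)).

(* The operator T below is |A|, the positive square root of A^* A. *)
Definition trace_class (e : nat -> H) (A : bop H) :=
  exists T : bop H,
    [/\ positive_op T, T * T = adjoint A * A & summable_diag e T].

(* [trace_class] and [tr] do not depend on the orthonormal basis e. *)
Definition tr (e : nat -> H) (A : bop H) : R[i] :=
  limn (series (fun n => dot (A (e n)) (e n) : R[i]^o)).

(* [schatten e p] is the ideal written B_{2p}, so [schatten e 1] is the
   Hilbert-Schmidt class. *)
Definition schatten (e : nat -> H) (p : nat) (A : bop H) :=
  trace_class e ((adjoint A * A) ^+ p).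

End Operators.

Section Graded.
Context {R : realType} {H : completeNormedModType R[i]}.
Variables (dot : {dot H for Num.conj}) (e : nat -> H).
Variables (P : bool -> bop H) (F0 : bop H).

Definition gamma : bop H := P false - P true.

Definition part (a : bool) (A : bop H) : bop H :=
  \sum_(b : bool) P (a (+) b) * A * P b.

(* (-1)^{deg deg} for homogeneous arguments of degrees a and b. *)
Definition ksign (a b : bool) : R[i] := (-1) ^+ (a && b).

Definition scomm (A B : bop H) : bop H :=
  \sum_(a : bool) \sum_(b : bool)
    (part a A * part b B - ksign a b *: (part b B * part a A)).

Definition Gr (p : nat) (F : bop H) :=
  F * F = 1 /\ schatten dot e p (F - F0).

Definition gp (p : nat) (F X : bop H) := schatten dot e p (scomm F X).

Definition str (A : bop H) : R[i] := tr dot e (gamma * A).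

Definition strc_defined (A : bop H) := trace_class dot e (A + F0 * A * F0).

Definition strc (A : bop H) : R[i] :=
  2^-1 * tr dot e (gamma * (A + F0 * A * F0)).

(* Difference quotient in a real variable t; the derivative of the library
   requires the variable to range over the scalar field. *)
Definition lie_quotient (X : bop H) (m : bop H -> R[i]) (F : bop H) (t : R)
    : R[i]^o :=
  (m (F + t%:C%C *: scomm F X) - m F) / t%:C%C.

Definition lie_derivable (X : bop H) (m : bop H -> R[i]) (F : bop H) :=
  cvg (lie_quotient X m F t @[t --> (0 : R)^']).

Definition lie (X : bop H) (m : bop H -> R[i]) (F : bop H) : R[i] :=
  lim (lie_quotient X m F t @[t --> (0 : R)^']).

(* The formula for homogeneous X and Y of degrees a and b, then its bilinear
   extension. *)
Definition delta_homogeneous (zeta : bop H -> bop H -> R[i]) (a b : bool)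
    (X Y F : bop H) : R[i] :=
  zeta (scomm X Y) F - lie X (zeta Y) F + ksign a b * lie Y (zeta X) F.

Definition delta (zeta : bop H -> bop H -> R[i]) (X Y F : bop H) : R[i] :=
  \sum_(a : bool) \sum_(b : bool)
    delta_homogeneous zeta a b (part a X) (part b Y) F.

Definition c1_arg (X Y : bop H) : bop H := F0 * scomm F0 X * scomm F0 Y.

Definition c1 (X Y : bop H) : R[i] := - 4^-1 * str (c1_arg X Y).

Definition b1_arg (X F : bop H) : bop H := (F - F0) * F0 * scomm F0 X.

Definition b1 (X F : bop H) : R[i] := 8^-1 * str (b1_arg X F).

Definition c2 (X Y F : bop H) : R[i] := c1 X Y + delta b1 X Y F.

Definition rhs_arg (X Y F : bop H) : bop H :=
  (F - F0) * scomm (scomm F0 X) (scomm F0 Y).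

End Graded.

(* Main.v *)
Require Import Defs.
From HB Require Import structures.
From mathcomp Require Import all_boot all_order all_algebra.
From mathcomp Require Import complex.
From mathcomp Require Import boolp classical_sets functions cardinality reals.
From mathcomp Require Import topology normedtype sequences.
From mathcomp Require Import ring lra.
Set Implicit Arguments.
Unset Strict Implicit.
Unset Printing Implicit Defensive.

Import Order.TTheory GRing.Theory Num.Theory.
Import numFieldNormedType.Exports.
Local Open Scope classical_set_scope.
Local Open Scope ring_scope.

(* Put D = F - F0, x = [F0, X]_s, y = [F0, Y]_s and let J be the ideal B_{2p}.
   F0 is even while F need not be, and D, [F, X]_s in J give x, y in J.

   Identity (p = 1): for homogeneous X, Y the Lie derivative of the affine
   function b(Y; .) along X is str([F, X]_s F0 y) / 8.  Writing
   [F, X]_s = x + [D, X]_s, graded cyclicity of the trace turns the part of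
   delta b that is constant in D into str(F0 x y) / 4, which cancels c_1, and the
   part linear in D into str(D [x, y]_s) / 8.

   Existence (p = 2): F0 anticommutes with x and y, hence commutes with
   C = [x, y]_s, and F^2 = 1 gives D F0 + F0 D = - D^2; so for a = D C one has
   a + F0 a F0 = - D^2 F0 C, where D^2 and C are Hilbert-Schmidt, being
   combinations of products of two elements of B_4.

   Products of two Hilbert-Schmidt operators are trace class in the sense of
   the definition (through |A| and an approximate polar decomposition), and
   the trace of such a product is cyclic by polarization. *)

(** [trace_class] asks for a positive square root with a convergent diagonal series, and in this
    form neither sums nor products are visibly under control. All algebra is therefore carried out
    in the substitute classes [hs], [hs4] and [nuc], and the definition is met only at the two ends.
    On entry, uniqueness of positive roots identifies the root in a Schatten hypothesis with [A^* A]
    or its square. On exit, a modulus must be built without a spectral theorem, and as it need not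
    be invertible, the polar decomposition is replaced by one whose error vanishes in a limit. The
    ideal properties of [hs4] rest on one duality estimate against finite rank operators.

    In the identity [D] carries no degree, so signs can only be attached to [X] and [Y]. Moving an
    odd [X] past [D] leaves [gamma D gamma], and cyclicity has to carry this conjugation over to a
    homogeneous factor. As [X] and [Y] are merely bounded, a supertrace may be split only into terms
    that each keep two Hilbert-Schmidt factors. *)

Section RealLimits.
Context {R : realType}.
Implicit Types (d u : nat -> R).

Lemma le_lim0 (a b : R) N d : (forall n, (N <= n)%N -> a <= b + d n) ->
  d @ \oo --> (0 : R) -> a <= b.
Proof.
move=> abd /cvgrPdist_lt d0; rewrite leNgt; apply/negP => ba.
have /d0[M _ dM] : 0 < a - b by rewrite subr_gt0.
have /= := dM (maxn N M) (leq_maxr _ _); have := abd _ (leq_maxl N M).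
rewrite sub0r normrN => ? dlt; have := ler_norm (d (maxn N M)); lra.
Qed.

Lemma squeeze0 d u : (forall n, 0 <= d n <= u n) -> u @ \oo --> (0 : R) ->
  d @ \oo --> (0 : R).
Proof.
move=> du u0; apply: (squeeze_cvgr _ (cvg_cst 0) u0).
by apply: nearW => n; apply: du.
Qed.

Lemma cvg0D d u : d @ \oo --> (0 : R) -> u @ \oo --> (0 : R) ->
  (fun n => d n + u n) @ \oo --> (0 : R).
Proof. by move=> d0 u0; rewrite -[0 in X in _ --> X]addr0; apply: cvgD. Qed.

Lemma cvg0Z d c : d @ \oo --> (0 : R) -> (fun n => c * d n) @ \oo --> (0 : R).
Proof.
move=> d0; rewrite -[0 in X in _ --> X](mulr0 c).
by apply: cvgM d0; apply: cvg_cst.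
Qed.

Lemma cvg0_harmonic (c : R) : (fun n => c / n.+1%:R) @ \oo --> (0 : R).
Proof. by apply: cvg0Z; exact: cvg_harmonic. Qed.

Lemma bounded_sum_cvg (f : nat -> R) c : (forall n, 0 <= f n) ->
  (forall N, \sum_(n < N) f n <= c) ->
  exists l : R, (fun N => \sum_(n < N) f n) @ \oo --> l.
Proof.
move=> f0 fc; exists (limn (fun N => \sum_(n < N) f n)).
apply: nondecreasing_is_cvgn; last by exists c => _ [N _ <-].
apply/nondecreasing_seqP => n.
by rewrite big_ord_recr/= lerDl.
Qed.

End RealLimits.

(** * Modulus and convergence of complex sequences *)

Section Modulus.
Context {R : realType}.
Implicit Types z w : R[i].

Definition cmod z : R := complex.Re `|z|.

Lemma cmodE z : `|z| = (cmod z)%:C%C.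
Proof. by rewrite RRe_real// ger0_real. Qed.

Lemma cmod_ge0 z : 0 <= cmod z.
Proof. by have := normr_ge0 z; rewrite cmodE ler0c. Qed.

Lemma cmod0 : cmod 0 = 0. Proof. by rewrite /cmod normr0. Qed.

Lemma cmodD z w : cmod (z + w) <= cmod z + cmod w.
Proof. by rewrite -lecR rmorphD/= -!cmodE ler_normD. Qed.

Lemma cmodN z : cmod (- z) = cmod z.
Proof. by rewrite /cmod normrN. Qed.

Lemma cmodM z w : cmod (z * w) = cmod z * cmod w.
Proof. by apply: complexI; rewrite rmorphM/= -!cmodE normrM. Qed.

Lemma cmodJ z : cmod (Num.conj z) = cmod z.
Proof. by rewrite /cmod normcJ. Qed.

Lemma cmod_real (a : R) : cmod a%:C%C = `|a|.
Proof. by rewrite /cmod normc_def/= expr0n/= addr0 sqrtr_sqr. Qed.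

Lemma cmod_sqr z : z * Num.conj z = (cmod z ^+ 2)%:C%C.
Proof. by rewrite rmorphXn/= -cmodE -normCK. Qed.

Lemma Re_le_cmod z : complex.Re z <= cmod z.
Proof.
have := normc_ge_Re z; rewrite cmodE lecR; apply: le_trans; exact: ler_norm.
Qed.

Lemma ReD z w : complex.Re (z + w) = complex.Re z + complex.Re w.
Proof. by case: z w => [? ?] [? ?]. Qed.

Lemma ReN z : complex.Re (- z) = - complex.Re z.
Proof. by case: z. Qed.

Lemma ReJ z : complex.Re (Num.conj z) = complex.Re z.
Proof. by case: z. Qed.

Lemma ReZ (a : R) z : complex.Re (a%:C%C * z) = a * complex.Re z.
Proof. by case: z => b c /=; rewrite mul0r subr0. Qed.

Lemma Re_sum I (r : seq I) (Q : pred I) (f : I -> R[i]) :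
  complex.Re (\sum_(i <- r | Q i) f i) = \sum_(i <- r | Q i) complex.Re (f i).
Proof. by apply: (big_morph (fun z => complex.Re z)) => // z w; rewrite ReD. Qed.

(** Stated through a real null sequence, so that squeezing takes place in [R] and not in the
    partially ordered [R[i]]; [cvCP] returns to the library notion. [cvH] below follows the same
    pattern. *)
Definition cvC (u : nat -> R[i]) z := (fun n => cmod (u n - z)) @ \oo --> (0 : R).

Lemma cvCP u z : cvC u z <-> (u : nat -> R[i]^o) @ \oo --> (z : R[i]^o).
Proof.
split=> [/cvgrPdist_lt uz|/cvgrPdist_lt uz]; apply/cvgrPdist_lt => eps eps0.
  have epsE : eps = (complex.Re eps)%:C%C by rewrite RRe_real// gtr0_real.
  have /uz[N _ uN] : 0 < complex.Re eps by rewrite -ltcR -epsE.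
  exists N => // n /uN; rewrite /= sub0r normrN ger0_norm ?cmod_ge0//.
  by move=> /= lt; rewrite distrC cmodE epsE ltcR.
have /uz[N _ uN] : 0 < eps%:C%C by rewrite ltcR.
exists N => // n /uN /=; rewrite distrC cmodE ltcR => lt.
by rewrite /= sub0r normrN ger0_norm ?cmod_ge0.
Qed.

Lemma cvC_uniq u z w : cvC u z -> cvC u w -> z = w.
Proof. by move=> /cvCP uz /cvCP uw; exact: (cvg_unique _ uz uw). Qed.

Lemma cvC_ext u v z : u =1 v -> cvC u z -> cvC v z.
Proof. by move=> /funext ->. Qed.

Lemma cvC_cst z : cvC (fun=> z) z.
Proof. by rewrite /cvC subrr cmod0; exact: cvg_cst. Qed.

Lemma cvCD u v z w : cvC u z -> cvC v w -> cvC (fun n => u n + v n) (z + w).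
Proof.
move=> uz vw; apply: squeeze0 (cvg0D uz vw) => n; rewrite cmod_ge0/=.
by rewrite opprD addrACA cmodD.
Qed.

Lemma cvCZ c u z : cvC u z -> cvC (fun n => c * u n) (c * z).
Proof.
move=> uz; apply: squeeze0 (cvg0Z (cmod c) uz) => n; rewrite cmod_ge0/=.
by rewrite -mulrBr cmodM.
Qed.

Lemma cvC_sum I (r : seq I) (u : I -> nat -> R[i]) (z : I -> R[i]) :
  (forall i, cvC (u i) (z i)) ->
  cvC (fun n => \sum_(i <- r) u i n) (\sum_(i <- r) z i).
Proof.
move=> uz; elim: r => [|i r IHr].
  by rewrite big_nil; apply: cvC_ext (cvC_cst 0) => n; rewrite big_nil.
rewrite big_cons; apply: cvC_ext (cvCD (uz i) IHr) => n.
by rewrite big_cons.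
Qed.

Lemma cvC_real (u : nat -> R) (l : R) : u @ \oo --> l -> cvC (fun n => (u n)%:C%C) l%:C%C.
Proof.
move=> ul; apply: (@squeeze0 _ _ (fun n => `|u n - l|)) => [n|].
  by rewrite cmod_ge0/= -rmorphB/= cmod_real.
rewrite -[0 in X in _ --> X](@normr0 _ R) -(subrr l); apply: cvg_norm.
by apply: cvgB => //; exact: cvg_cst.
Qed.

Lemma Re_lim_le u z (a : R) : cvC u z -> (forall n, complex.Re (u n) <= a) ->
  complex.Re z <= a.
Proof.
move=> uz ua; apply: (@le_lim0 _ _ _ 0 _ _ uz) => n _.
have := Re_le_cmod (- (u n - z)); rewrite cmodN ReN ReD ReN.
by have := ua n; lra.
Qed.

End Modulus.

(** * Bounded operators and the inner product *)

Section BoundedAlgebra.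
Context {R : realType} {H : completeNormedModType R[i]}.
Implicit Types (A B C : bop H) (x y : H).

Lemma bop_ext A B : (forall x, A x = B x) -> A = B.
Proof. by move=> AB; apply: val_inj; apply/funext => x; exact: AB. Qed.

Lemma bop_at0 A : A 0 = 0.
Proof. by have := bop_linear A (-1) 0 0; rewrite scaler0 addr0 scaleN1r addNr. Qed.

Lemma bop_atD A x y : A (x + y) = A x + A y.
Proof. by rewrite -[x in LHS]scale1r bop_linear scale1r. Qed.

Lemma bop_atZ A a x : A (a *: x) = a *: A x.
Proof. by have := bop_linear A a x 0; rewrite bop_at0 !addr0. Qed.

Lemma bop_atN A x : A (- x) = - A x.
Proof. by rewrite -scaleN1r bop_atZ scaleN1r. Qed.

Lemma bop_atB A x y : A (x - y) = A x - A y.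
Proof. by rewrite bop_atD bop_atN. Qed.

Lemma bop_at_sum A I (r : seq I) (f : I -> H) :
  A (\sum_(i <- r) f i) = \sum_(i <- r) A (f i).
Proof. by apply: (big_morph A) => [x y|]; rewrite ?bop_atD ?bop_at0. Qed.

Lemma add_bopE A B x : (A + B) x = A x + B x.
Proof. by []. Qed.

Lemma opp_bopE A x : (- A) x = - A x.
Proof. by []. Qed.

Lemma mul_bopE A B x : (A * B) x = A (B x).
Proof. by []. Qed.

Lemma scale_bopE a A x : (a *: A) x = a *: A x.
Proof. by []. Qed.

Lemma bop_scalerAl a A B : (a *: A) * B = a *: (A * B).
Proof. exact: bop_ext. Qed.

Lemma bop_scalerAr a A B : A * (a *: B) = a *: (A * B).
Proof. by apply: bop_ext => x; exact: bop_atZ. Qed.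

Definition nrm x : R := complex.Re `|x|.

Lemma nrmE x : `|x| = (nrm x)%:C%C.
Proof. by rewrite RRe_real// ger0_real. Qed.

Lemma nrm_ge0 x : 0 <= nrm x.
Proof. by have := normr_ge0 x; rewrite nrmE ler0c. Qed.

Lemma nrm0 : nrm 0 = 0. Proof. by rewrite /nrm normr0. Qed.

Lemma nrm_eq0 x : nrm x = 0 -> x = 0.
Proof. by move=> x0; apply/normr0_eq0; rewrite nrmE x0. Qed.

Lemma nrmD x y : nrm (x + y) <= nrm x + nrm y.
Proof. by rewrite -lecR rmorphD/= -!nrmE ler_normD. Qed.

Lemma nrmN x : nrm (- x) = nrm x.
Proof. by rewrite /nrm normrN. Qed.

Lemma nrmB x y : nrm (x - y) <= nrm x + nrm y.
Proof. by rewrite -[nrm y]nrmN nrmD. Qed.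

Lemma nrmBC x y : nrm (x - y) = nrm (y - x).
Proof. by rewrite -nrmN opprB. Qed.

Lemma nrmZ a x : nrm (a *: x) = cmod a * nrm x.
Proof. by apply: complexI; rewrite rmorphM/= -!nrmE -cmodE normrZ. Qed.

Definition bnd (c : R) A := forall x, nrm (A x) <= c * nrm x.

Lemma bop_bnd A : exists2 c : R, 0 < c & bnd c A.
Proof.
have /asboolP[_ [M M0 AM]] := bopP A.
have ME : M = (complex.Re M)%:C%C by rewrite RRe_real// ger0_real.
exists (complex.Re M + 1) => [|x].
  by move: M0; rewrite ME ler0c; lra.
have := AM x; rewrite !nrmE ME -rmorphM/= lecR => /le_trans; apply.
by rewrite ler_wpM2r ?nrm_ge0//; lra.
Qed.

Lemma bnd_weak (c c' : R) A : c <= c' -> bnd c A -> bnd c' A.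
Proof. by move=> cc Ac x; rewrite (le_trans (Ac x))// ler_wpM2r// nrm_ge0. Qed.

Lemma bnd1 : bnd 1 1.
Proof. by move=> x; rewrite mul1r. Qed.

Lemma bndM (c d : R) A B : 0 <= c -> bnd c A -> bnd d B -> bnd (c * d) (A * B).
Proof.
by move=> c0 Ac Bd x; rewrite (le_trans (Ac _))// -mulrA ler_wpM2l.
Qed.

Lemma bndD (c d : R) A B : bnd c A -> bnd d B -> bnd (c + d) (A + B).
Proof. by move=> Ac Bd x; rewrite add_bopE (le_trans (nrmD _ _))// mulrDl lerD. Qed.

Lemma bndN (c : R) A : bnd c A -> bnd c (- A).
Proof. by move=> Ac x; rewrite opp_bopE nrmN. Qed.

Lemma bndZ (c : R) a A : bnd c A -> bnd (cmod a * c) (a *: A).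
Proof. by move=> Ac x; rewrite scale_bopE nrmZ -mulrA ler_wpM2l ?cmod_ge0. Qed.

Lemma bop_construct (f : H -> H) (c : R) : linear f -> 0 <= c ->
  (forall x, nrm (f x) <= c * nrm x) -> exists A : bop H, forall x, A x = f x.
Proof.
move=> f_lin c0 fc.
have fP : f \in bounded_pred.
  apply/asboolP; split=> //; exists c%:C%C => [|x]; first by rewrite ler0c.
  by rewrite !nrmE -rmorphM/= lecR.
by exists (Bop fP).
Qed.

Definition cvH (u : nat -> H) x := (fun n => nrm (u n - x)) @ \oo --> (0 : R).

Lemma cvHP u x : cvH u x <-> u @ \oo --> x.
Proof.
split=> [/cvgrPdist_lt ux|/cvgrPdist_lt ux]; apply/cvgrPdist_lt => eps eps0.
  have epsE : eps = (complex.Re eps)%:C%C by rewrite RRe_real// gtr0_real.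
  have /ux[N _ uN] : 0 < complex.Re eps by rewrite -ltcR -epsE.
  exists N => // n /uN; rewrite /= sub0r normrN ger0_norm ?nrm_ge0//.
  by move=> /= lt; rewrite distrC nrmE epsE ltcR.
have /ux[N _ uN] : 0 < eps%:C%C by rewrite ltcR.
exists N => // n /uN /=; rewrite distrC nrmE ltcR => lt.
by rewrite /= sub0r normrN ger0_norm ?nrm_ge0.
Qed.

Lemma cvH_uniq u x y : cvH u x -> cvH u y -> x = y.
Proof. by move=> /cvHP ux /cvHP uy; exact: (cvg_unique _ ux uy). Qed.

Lemma cvH_nrm_le u x (c : R) : (forall n, nrm (u n) <= c) -> cvH u x -> nrm x <= c.
Proof.
move=> uc ux; apply: (@le_lim0 _ _ _ 0 _ _ ux) => n _.
have -> : x = u n - (u n - x) by rewrite subKr.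
by rewrite (le_trans (nrmB _ _))// opprB addrCA subrr addr0 lerD.
Qed.

Lemma cvH_op A u x : cvH u x -> cvH (fun n => A (u n)) (A x).
Proof.
have [c c0 Ac] := bop_bnd A => ux.
by apply: squeeze0 (cvg0Z c ux) => n; rewrite nrm_ge0/= -bop_atB Ac.
Qed.

Lemma cvHD u v x y : cvH u x -> cvH v y -> cvH (fun n => u n + v n) (x + y).
Proof.
move=> ux vy; apply: squeeze0 (cvg0D ux vy) => n; rewrite nrm_ge0/=.
by rewrite opprD addrACA nrmD.
Qed.

Lemma cvHZ a u x : cvH u x -> cvH (fun n => a *: u n) (a *: x).
Proof.
move=> ux; apply: squeeze0 (cvg0Z (cmod a) ux) => n; rewrite nrm_ge0/=.
by rewrite -scalerBr nrmZ.
Qed.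

(** The square suits partial sums of orthogonal expansions, where Pythagoras gives equality. Once
    [t] is within [r^2 / 2] of its limit, [u] moves by less than [r]. *)
Lemma cvH_complete u (t : nat -> R) (l : R) : t @ \oo --> l ->
  (forall m n, (m <= n)%N -> nrm (u n - u m) ^+ 2 <= t n - t m) ->
  exists x, cvH u x.
Proof.
move=> /cvgrPdist_lt tl ut.
suff : cvgn u by move=> /cvgP ?; exists (limn u); apply/cvHP.
apply: cauchy_cvg; apply: cauchy_exP => eps eps0.
have epsE : eps = (complex.Re eps)%:C%C by rewrite RRe_real// gtr0_real.
have eps'0 : 0 < complex.Re eps by rewrite -ltcR -epsE.
set r := complex.Re eps in epsE eps'0.
have /tl[N _ tN] : 0 < r ^+ 2 / 2 by rewrite divr_gt0// exprn_gt0.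
exists (u N), N => // n /= Nn; rewrite -ball_normE /= nrmE epsE ltcR nrmBC.
rewrite -(@ltr_pXn2r _ 2) ?nnegrE ?nrm_ge0 ?ltW//.
rewrite (le_lt_trans (ut _ _ Nn))//.
have := tN _ (leqnn N); have := tN _ Nn => /=.
have := ler_norm (l - t N); have := ler_norm (- (l - t n)); rewrite normrN.
lra.
Qed.
End BoundedAlgebra.

(** * Inner product, orthonormal expansions and adjoints *)

Section InnerProduct.
Context {R : realType} {H : completeNormedModType R[i]}.
Variable dot : {dot H for Num.conj}.
Hypothesis norm_dot : forall x : H, `|x| ^+ 2 = dot x x.
Implicit Types (A B : bop H) (x y z : H).

Lemma dotC x y : dot x y = Num.conj (dot y x).
Proof. by rewrite hermC expr0 mul1r. Qed.

Lemma dotDl x y z : dot (x + y) z = dot x z + dot y z.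
Proof. exact: linearDl. Qed.

Lemma dotDr x y z : dot z (x + y) = dot z x + dot z y.
Proof. exact: linearDr. Qed.

Lemma dotZl a x y : dot (a *: x) y = a * dot x y.
Proof. exact: linearZl_LR. Qed.

Lemma dotZr a x y : dot x (a *: y) = Num.conj a * dot x y.
Proof. exact: linearZr_LR. Qed.

Lemma dotNl x y : dot (- x) y = - dot x y.
Proof. exact: linearNl. Qed.

Lemma dotNr x y : dot x (- y) = - dot x y.
Proof. exact: linearNr. Qed.

Lemma dot0l x : dot 0 x = 0.
Proof. exact: linear0l. Qed.

Lemma dot0r x : dot x 0 = 0.
Proof. exact: linear0r. Qed.

Lemma dotBl x y z : dot (x - y) z = dot x z - dot y z.
Proof. exact: linearBl. Qed.

Lemma dotBr x y z : dot z (x - y) = dot z x - dot z y.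
Proof. exact: linearBr. Qed.

Lemma dot_suml I (r : seq I) (f : I -> H) y :
  dot (\sum_(i <- r) f i) y = \sum_(i <- r) dot (f i) y.
Proof. exact: linear_sumlz. Qed.

Lemma dot_sumr I (r : seq I) (f : I -> H) y :
  dot y (\sum_(i <- r) f i) = \sum_(i <- r) dot y (f i).
Proof. exact: linear_sumr. Qed.

Lemma dotxx x : dot x x = (nrm x ^+ 2)%:C%C.
Proof. by rewrite -norm_dot nrmE rmorphXn. Qed.

Lemma nrm_sqrE x : nrm x ^+ 2 = complex.Re (dot x x).
Proof. by rewrite dotxx. Qed.

Lemma ReC_dot x y : complex.Re (dot x y) = complex.Re (dot y x).
Proof. by rewrite dotC ReJ. Qed.

Lemma nrmD_sqr x y :
  nrm (x + y) ^+ 2 = nrm x ^+ 2 + nrm y ^+ 2 + 2 * complex.Re (dot x y).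
Proof.
rewrite !nrm_sqrE dotDl !dotDr !ReD (ReC_dot y x); ring.
Qed.

Lemma nrmB_sqr x y :
  nrm (x - y) ^+ 2 = nrm x ^+ 2 + nrm y ^+ 2 - 2 * complex.Re (dot x y).
Proof. rewrite nrmD_sqr nrmN dotNr ReN; ring. Qed.

Lemma Re_dot_le_half x y :
  2 * complex.Re (dot x y) <= nrm x ^+ 2 + nrm y ^+ 2.
Proof. by have := sqr_ge0 (nrm (x - y)); rewrite nrmB_sqr; lra. Qed.

Lemma Re_cauchy_schwarz x y : complex.Re (dot x y) <= nrm x * nrm y.
Proof.
have [/nrm_eq0->|x0] := eqVneq (nrm x) 0; first by rewrite dot0l nrm0 mul0r.
have [/nrm_eq0->|y0] := eqVneq (nrm y) 0; first by rewrite dot0r nrm0 mulr0.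
have xgt0 : 0 < nrm x by rewrite lt_def x0 nrm_ge0.
have ygt0 : 0 < nrm y by rewrite lt_def y0 nrm_ge0.
(* The two rescaled vectors have equal norm, which makes the arithmetic-geometric bound the sharp
   one. *)
have := Re_dot_le_half ((nrm y)%:C%C *: x) ((nrm x)%:C%C *: y).
rewrite dotZl dotZr !nrmZ !cmod_real !ger0_norm ?nrm_ge0//.
rewrite [Num.conj _]conjc_real !ReZ => le.
rewrite -(ler_pM2l (mulr_gt0 xgt0 ygt0)); nra.
Qed.

Lemma cauchy_schwarz x y : cmod (dot x y) <= nrm x * nrm y.
Proof.
have [->|z0] := eqVneq (cmod (dot x y)) 0; first by rewrite mulr_ge0 ?nrm_ge0.
have zgt0 : 0 < cmod (dot x y) by rewrite lt_def z0 cmod_ge0.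
(* This multiple of [x] turns the inner product into the real number [|<x, y>|^2]. *)
have := Re_cauchy_schwarz (Num.conj (dot x y) *: x) y.
rewrite dotZl mulrC cmod_sqr /= nrmZ cmodJ -mulrA.
by rewrite expr2 ler_pM2l.
Qed.

Lemma polarization x y : 4 * dot x y =
  (nrm (x + y) ^+ 2)%:C%C - (nrm (x - y) ^+ 2)%:C%C +
  'i%C * ((nrm (x + 'i%C *: y) ^+ 2)%:C%C - (nrm (x - 'i%C *: y) ^+ 2)%:C%C).
Proof.
rewrite -!dotxx !(dotDl, dotDr, dotNl, dotNr, dotZl, dotZr).
have -> : Num.conj ('i%C : R[i]) = - 'i%C by simpc.
have ii : 'i%C * 'i%C = -1 :> R[i] by rewrite -expr2 sqr_i.
ring: ii.
Qed.

Lemma cvC_dotl u x y : cvH u x -> cvC (fun n => dot (u n) y) (dot x y).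
Proof.
move=> ux; apply: squeeze0 (cvg0Z (nrm y) ux) => n; rewrite cmod_ge0/=.
by rewrite -dotBl mulrC cauchy_schwarz.
Qed.

Lemma cvC_dotr u x y : cvH u x -> cvC (fun n => dot y (u n)) (dot y x).
Proof.
move=> ux; apply: squeeze0 (cvg0Z (nrm y) ux) => n; rewrite cmod_ge0/=.
by rewrite -dotBr cauchy_schwarz.
Qed.

Lemma dot_eq x y : (forall z, dot x z = dot y z) -> x = y.
Proof.
move=> xy; apply/eqP; rewrite -subr_eq0; apply/eqP/nrm_eq0.
have := dotxx (x - y); rewrite dotBl xy subrr => /(congr1 (@complex.Re R)) /=.
by move/esym/eqP; rewrite sqrf_eq0 => /eqP.
Qed.

Section Basis.
Variable e : nat -> H.
Hypothesis onb_e : orthonormal_basis dot e.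

Let dot_e m n : dot (e m) (e n) = (m == n)%:R.
Proof. by case: onb_e. Qed.

Lemma dot_expansion (c : nat -> R[i]) N m :
  dot (\sum_(n < N) c n *: e n) (e m) = if (m < N)%N then c m else 0.
Proof.
rewrite dot_suml; case: ifP => [mN|/negbT mN].
  rewrite (bigD1 (Ordinal mN))//= dotZl dot_e eqxx mulr1 big1 ?addr0// => i im.
  by rewrite dotZl dot_e -(inj_eq val_inj) /= in im * ; rewrite (negbTE im) mulr0.
rewrite big1// => i _; rewrite dotZl dot_e; case: eqP => [im|]; last by rewrite mulr0.
by rewrite -im ltn_ord in mN.
Qed.

Lemma dot_expansions (c : nat -> R[i]) M N : (M <= N)%N ->
  dot (\sum_(n < N) c n *: e n) (\sum_(n < M) c n *: e n) =
  (\sum_(n < M) cmod (c n) ^+ 2)%:C%C.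
Proof.
move=> MN; rewrite dot_sumr rmorph_sum; apply: eq_bigr => i _ /=.
rewrite dotZr dot_expansion (leq_trans (ltn_ord i) MN) mulrC.
exact: cmod_sqr.
Qed.

Lemma nrm_expansion (c : nat -> R[i]) N :
  nrm (\sum_(n < N) c n *: e n) ^+ 2 = \sum_(n < N) cmod (c n) ^+ 2.
Proof. by rewrite nrm_sqrE dot_expansions. Qed.

Lemma nrm_expansionB (c : nat -> R[i]) M N : (M <= N)%N ->
  nrm (\sum_(n < N) c n *: e n - \sum_(n < M) c n *: e n) ^+ 2 =
  \sum_(n < N) cmod (c n) ^+ 2 - \sum_(n < M) cmod (c n) ^+ 2.
Proof.
by move=> MN; rewrite nrmB_sqr !nrm_expansion dot_expansions//=; ring.
Qed.

Lemma expansion_cvH x : cvH (fun N => \sum_(n < N) dot x (e n) *: e n) x.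
Proof.
apply/cvHP; case: onb_e => _ /(_ x); rewrite /series /=.
by under eq_fun do rewrite big_mkord.
Qed.

Lemma bessel_eq x N : nrm (\sum_(n < N) dot x (e n) *: e n - x) ^+ 2 =
  nrm x ^+ 2 - \sum_(n < N) cmod (dot x (e n)) ^+ 2.
Proof.
rewrite nrmB_sqr (nrm_expansion (fun n => dot x (e n))).
suff -> : dot (\sum_(n < N) dot x (e n) *: e n) x =
    (\sum_(n < N) cmod (dot x (e n)) ^+ 2)%:C%C by rewrite /=; ring.
rewrite dot_suml rmorph_sum; apply: eq_bigr => i _ /=.
by rewrite dotZl (dotC (e i)); exact: cmod_sqr.
Qed.

Lemma bessel x N : \sum_(n < N) cmod (dot x (e n)) ^+ 2 <= nrm x ^+ 2.
Proof. by rewrite -subr_ge0 -bessel_eq sqr_ge0. Qed.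

Lemma parseval x :
  (fun N => nrm x ^+ 2 - \sum_(n < N) cmod (dot x (e n)) ^+ 2) @ \oo --> (0 : R).
Proof.
pose r N := nrm (\sum_(n < N) dot x (e n) *: e n - x).
rewrite (_ : (fun _ => _) = (fun N => r N * r N)); last first.
  by apply/funext => N; rewrite -bessel_eq expr2.
by rewrite -[0 in X in _ --> X](mulr0 0); apply: cvgM; exact: expansion_cvH.
Qed.

Lemma parseval_dot x y : cvC (fun N => \sum_(n < N) dot x (e n) * dot (e n) y) (dot x y).
Proof.
apply: cvC_ext (cvC_dotl y (expansion_cvH x)) => N.
by rewrite dot_suml; apply: eq_bigr => i _; rewrite dotZl.
Qed.

Lemma cvH_l2 (c : nat -> R[i]) (M : R) :
  (forall N, \sum_(n < N) cmod (c n) ^+ 2 <= M) ->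
  exists x, cvH (fun N => \sum_(n < N) c n *: e n) x.
Proof.
move=> cM; have [l cl] := bounded_sum_cvg (fun n => sqr_ge0 (cmod (c n))) cM.
by apply: (cvH_complete cl) => m n mn; rewrite nrm_expansionB.
Qed.

(** The adjoint is built from its coefficients, as the sum of [<y, A e_n> e_n]. Its partial sums [s]
    satisfy [|s|^2 = Re <y, A s> <= k |y| |s|], which yields both convergence and the bound. *)
Lemma adjoint_exists A : exists B, forall x y, dot (A x) y = dot x (B y).
Proof.
have [k k0 Ak] := bop_bnd A.
pose s y N := \sum_(n < N) dot y (A (e n)) *: e n.
have sE y N : nrm (s y N) <= k * nrm y.
  have [->|s0] := eqVneq (nrm (s y N)) 0; first by rewrite mulr_ge0 ?nrm_ge0 ?ltW.
  have sgt0 : 0 < nrm (s y N) by rewrite lt_def s0 nrm_ge0.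
  rewrite -(ler_pM2r sgt0) -expr2.
  have -> : nrm (s y N) ^+ 2 = complex.Re (dot y (A (s y N))).
    rewrite (nrm_expansion (fun n => dot y (A (e n)))) bop_at_sum dot_sumr Re_sum.
    apply: eq_bigr => i _; rewrite bop_atZ dotZr mulrC.
    by rewrite cmod_sqr.
  rewrite (le_trans (Re_cauchy_schwarz _ _))// -mulrA mulrCA.
  by rewrite ler_wpM2l ?nrm_ge0.
have lim y : exists x, cvH (s y) x.
  apply: (@cvH_l2 (fun n => dot y (A (e n))) ((k * nrm y) ^+ 2)) => N.
  rewrite -(nrm_expansion (fun n => dot y (A (e n)))) lerXn2r ?nnegrE ?nrm_ge0 ?sE//.
  by rewrite mulr_ge0 ?nrm_ge0 ?ltW.
have [f fP] := choice lim.
have adj x y : dot (A x) y = dot x (f y).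
  have Ax : cvC (fun N => dot (A (\sum_(n < N) dot x (e n) *: e n)) y) (dot (A x) y).
    exact: cvC_dotl (cvH_op _ (expansion_cvH x)).
  apply: (cvC_uniq Ax); apply: cvC_ext (cvC_dotr x (fP y)) => N.
  rewrite bop_at_sum dot_suml dot_sumr; apply: eq_bigr => i _.
  by rewrite bop_atZ dotZl dotZr -dotC mulrC.
have f_lin : linear f.
  move=> a x y; apply: dot_eq => z.
  rewrite dotC -adj -dotC !dotDl !dotZl (dotC (f x)) (dotC (f y)) -!adj.
  by rewrite -!dotC.
have [B BE] : exists B : bop H, forall x, B x = f x.
  apply: (bop_construct f_lin (ltW k0)) => y.
  exact: cvH_nrm_le (sE y) (fP y).
by exists B => x y; rewrite BE.
Qed.

(** Existence of an adjoint rules out the default value [0] of [xget]. *)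
Lemma adjointP A x y : dot (A x) y = dot x (adjoint dot A y).
Proof.
have [B AB] := adjoint_exists A.
by rewrite /adjoint; case: xgetP => [C _ /= ->//|/(_ B)]; case.
Qed.

Lemma adjointPr A x y : dot x (A y) = dot (adjoint dot A x) y.
Proof. by rewrite dotC adjointP -dotC. Qed.

Lemma adjoint_eq A B : (forall x y, dot (A x) y = dot x (B y)) -> adjoint dot A = B.
Proof.
move=> AB; apply: bop_ext => y; apply: dot_eq => x.
by rewrite dotC -adjointP AB -dotC.
Qed.

Lemma adjointK A : adjoint dot (adjoint dot A) = A.
Proof. by apply: adjoint_eq => x y; rewrite adjointPr. Qed.

Lemma adjointM A B : adjoint dot (A * B) = adjoint dot B * adjoint dot A.
Proof. by apply: adjoint_eq => x y; rewrite !mul_bopE !adjointP. Qed.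

Lemma adjointD A B : adjoint dot (A + B) = adjoint dot A + adjoint dot B.
Proof. by apply: adjoint_eq => x y; rewrite !add_bopE dotDl dotDr !adjointP. Qed.

Lemma adjointN A : adjoint dot (- A) = - adjoint dot A.
Proof. by apply: adjoint_eq => x y; rewrite !opp_bopE dotNl dotNr !adjointP. Qed.

Lemma adjointZ a A : adjoint dot (a *: A) = Num.conj a *: adjoint dot A.
Proof.
apply: adjoint_eq => x y; rewrite !scale_bopE dotZl dotZr adjointP.
by rewrite [Num.conj (Num.conj a)]conjcK.
Qed.

Lemma adjoint1 : adjoint dot 1 = 1.
Proof. exact: adjoint_eq. Qed.

End Basis.
End InnerProduct.

Lemma cvg0_sum {R : realType} I (r : seq I) (u : I -> nat -> R) :
  (forall i, u i @ \oo --> (0 : R)) ->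
  (fun n => \sum_(i <- r) u i n) @ \oo --> (0 : R).
Proof.
move=> u0; elim: r => [|i r IHr].
  by rewrite (_ : (fun _ => _) = cst 0); [exact: cvg_cst|
    apply/funext => n; rewrite big_nil].
rewrite (_ : (fun _ => _) = (fun n => u i n + \sum_(j <- r) u j n)).
  exact: cvg0D.
by apply/funext => n; rewrite big_cons.
Qed.

(** * Hilbert-Schmidt operators and the trace *)

Section HilbertSchmidt.
Context {R : realType} {H : completeNormedModType R[i]}.
Variable dot : {dot H for Num.conj}.
Hypothesis norm_dot : forall x : H, `|x| ^+ 2 = dot x x.
Variable e : nat -> H.
Hypothesis onb_e : orthonormal_basis dot e.
Implicit Types (A B C : bop H) (x y z : H).
Local Notation adj := (adjoint dot).
Let adjP := adjointP norm_dot onb_e.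
Let adjPr := adjointPr norm_dot onb_e.

Definition hsq A N : R := \sum_(n < N) nrm (A (e n)) ^+ 2.
(** A bound on all partial sums stands for a bound on the squared Hilbert-Schmidt norm, so most
    estimates need no infinite sum. *)
Definition hsle (c : R) A := forall N, hsq A N <= c.
Definition hs A := exists c, hsle c A.

(** Both sides are sums of [|<A e_m, e_n>|^2] in different orders. Parseval expands the finitely
    many vectors [A^* e_n] up to an error [r], the finite sums are exchanged, and Bessel bounds the
    result by [hsq A M]. *)
Lemma hsle_adj c A : hsle c A -> hsle c (adj A).
Proof.
move=> Ac N.
pose r n M := nrm (adj A (e n)) ^+ 2 - \sum_(m < M) cmod (dot (adj A (e n)) (e m)) ^+ 2.
have r0 : (fun M => \sum_(n < N) r n M) @ \oo --> (0 : R).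
  by apply: cvg0_sum => n; exact: (parseval norm_dot onb_e).
apply: (@le_lim0 _ _ _ 0 _ _ r0) => M _.
rewrite /r sumrB addrCA lerDl subr_ge0.
apply: le_trans (Ac M); rewrite exchange_big; apply: ler_sum => m _ /=.
rewrite (le_trans _ (bessel norm_dot onb_e (A (e m)) N))// le_eqVlt.
by apply/orP; left; apply/eqP; apply: eq_bigr => n _; rewrite -adjPr dotC cmodJ.
Qed.

Lemma hs_adj A : hs A -> hs (adj A).
Proof. by move=> [c Ac]; exists c; exact: hsle_adj. Qed.

Lemma hsle_mull c k A B : hsle c A -> bnd k B -> hsle (k ^+ 2 * c) (B * A).
Proof.
move=> Ac Bk N; rewrite (@le_trans _ _ (k ^+ 2 * hsq A N))//.
  rewrite mulr_sumr; apply: ler_sum => i _; rewrite -exprMn lerXn2r ?nnegrE ?nrm_ge0//.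
    exact: le_trans (nrm_ge0 _) (Bk _).
  exact: Bk.
by rewrite ler_wpM2l ?sqr_ge0.
Qed.

Lemma hs_mull A B : hs A -> hs (B * A).
Proof.
move=> [c Ac]; have [k _ Bk] := bop_bnd B.
by exists (k ^+ 2 * c); exact: hsle_mull.
Qed.

Lemma hs_mulr A B : hs A -> hs (A * B).
Proof.
move=> /hs_adj /(hs_mull (adj B)) /hs_adj.
by rewrite -(adjointM norm_dot onb_e) (adjointK norm_dot onb_e).
Qed.

Lemma hsD A B : hs A -> hs B -> hs (A + B).
Proof.
move=> [c Ac] [d Bd]; exists (2 * c + 2 * d) => N.
apply: (@le_trans _ _ (2 * hsq A N + 2 * hsq B N)); last first.
  by have := Ac N; have := Bd N; lra.
rewrite !mulr_sumr -big_split; apply: ler_sum => i _.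
rewrite add_bopE (nrmD_sqr norm_dot) /=.
have := Re_dot_le_half norm_dot (A (e i)) (B (e i)); lra.
Qed.

Lemma hsqZ a A N : cmod a = 1 -> hsq (a *: A) N = hsq A N.
Proof.
by move=> a1; apply: eq_bigr => i _; rewrite scale_bopE nrmZ a1 mul1r.
Qed.

Lemma hsZ a A : hs A -> hs (a *: A).
Proof. by move=> /(hs_mull (a *: (1 : bop H))); rewrite bop_scalerAl mul1r. Qed.

Lemma hsN A : hs A -> hs (- A).
Proof. by rewrite -scaleN1r; exact: hsZ. Qed.

Lemma hsB A B : hs A -> hs B -> hs (A - B).
Proof. by move=> hA /hsN; exact: hsD. Qed.

Lemma hs_lim A : hs A -> exists l : R,
  [/\ hsq A @ \oo --> l, hsle l A & forall c, hsle c A -> l <= c].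
Proof.
move=> [c Ac].
have [l Al] := bounded_sum_cvg (fun n => sqr_ge0 (nrm (A (e n)))) Ac.
have Al0 : (fun N => `|hsq A N - l|) @ \oo --> (0 : R).
  rewrite -[0 in X in _ --> X](@normr0 _ R) -(subrr l); apply: cvg_norm.
  by apply: cvgB => //; exact: cvg_cst.
exists l; split=> // [N|d Ad].
  apply: (@le_lim0 _ _ _ N _ _ Al0) => M NM.
  have := ler_norm (hsq A M - l); suff : hsq A N <= hsq A M by lra.
  rewrite /hsq -(subnKC NM) big_split_ord/= lerDl.
  by apply: sumr_ge0 => i _; exact: sqr_ge0.
apply: (@le_lim0 _ _ _ 0 _ _ Al0) => M _.
by have := ler_norm (- (hsq A M - l)); rewrite normrN; have := Ad M; lra.
Qed.

(** The limit is the least bound on the partial sums, and by [hsle_adj] an operator and its adjoint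
    have the same bounds. *)
Lemma hsq_adj_lim A (l : R) : hs A -> hsq A @ \oo --> l -> hsq (adj A) @ \oo --> l.
Proof.
move=> hA Al; have [l1 [Al1 Ale1 Amin1]] := hs_lim hA.
have [l2 [Al2 Ale2 Amin2]] := hs_lim (hs_adj hA).
have -> : l = l1 by exact: (cvg_unique _ Al Al1).
suff -> : l1 = l2 by [].
apply/eqP; rewrite eq_le Amin2 ?andbT; last exact: hsle_adj.
by rewrite Amin1// -(adjointK norm_dot onb_e A); exact: hsle_adj.
Qed.

Lemma sum_polarization A B N : \sum_(n < N) dot (A (e n)) (B (e n)) =
  4^-1 * ((hsq (A + B) N)%:C%C + -1 * (hsq (A - B) N)%:C%C +
  ('i%C * (hsq (A + 'i%C *: B) N)%:C%C + (- 'i%C) * (hsq (A - 'i%C *: B) N)%:C%C)).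
Proof.
apply: (@mulfI _ 4); first by rewrite pnatr_eq0.
rewrite mulrA mulfV ?pnatr_eq0// mul1r /hsq !rmorph_sum !mulr_sumr -!big_split.
apply: eq_bigr => i _; rewrite (polarization norm_dot).
rewrite !add_bopE !opp_bopE !scale_bopE /=; ring.
Qed.

(** This is the source of cyclicity. Polarization turns both series into four squared
    Hilbert-Schmidt norms, and the operators match up to adjoints and unit scalars: for instance
    [B^* + i A^* = i (A + i B)^*]. *)
Lemma hs_pairing A B : hs A -> hs B -> exists z : R[i],
  cvC (fun N => \sum_(n < N) dot (A (e n)) (B (e n))) z /\
  cvC (fun N => \sum_(n < N) dot (adj B (e n)) (adj A (e n))) z.
Proof.
move=> hA hB; have hiB := hsZ 'i%C hB.
have ci : cmod ('i%C : R[i]) = 1 by rewrite /cmod normc_def/= expr0n expr1n/= add0r sqrtr1.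
have ji : Num.conj ('i%C : R[i]) = - 'i%C by simpc.
have ii : 'i%C * 'i%C = -1 :> R[i] by rewrite -expr2 sqr_i.
have aD := adjointD norm_dot onb_e.
have aN := adjointN norm_dot onb_e.
have aZ := adjointZ norm_dot onb_e.
have [l1 [l1P _ _]] := hs_lim (hsD hA hB).
have [l2 [l2P _ _]] := hs_lim (hsB hA hB).
have [l3 [l3P _ _]] := hs_lim (hsD hA hiB).
have [l4 [l4P _ _]] := hs_lim (hsB hA hiB).
exists (4^-1 * (l1%:C%C + -1 * l2%:C%C + ('i%C * l3%:C%C + (- 'i%C) * l4%:C%C))).
split; under [X in cvC X _]eq_fun do rewrite sum_polarization.
  by apply: cvCZ; apply: cvCD; apply: cvCD; do ?apply: cvCZ; exact: cvC_real.
apply: cvCZ; apply: cvCD; apply: cvCD; do ?apply: cvCZ; apply: cvC_real.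
- by rewrite addrC -aD; apply: hsq_adj_lim => //; exact: hsD.
- rewrite (_ : hsq _ = hsq (adj (A - B))); first by apply: hsq_adj_lim => //; exact: hsB.
  apply/funext => N; rewrite -(@hsqZ (-1)) ?cmodN ?cmod_real ?normr1//.
  by rewrite scaleN1r opprB aD aN.
- rewrite (_ : hsq _ = hsq (adj (A + 'i%C *: B))).
    by apply: hsq_adj_lim => //; exact: hsD.
  apply/funext => N; rewrite -[RHS](@hsqZ 'i%C)// aD aZ ji scalerDr scalerA mulrN ii.
  by rewrite opprK scale1r addrC.
- rewrite (_ : hsq _ = hsq (adj (A - 'i%C *: B))).
    by apply: hsq_adj_lim => //; exact: hsB.
  apply/funext => N; rewrite -[RHS](@hsqZ (- 'i%C)) ?cmodN// aD aN aZ ji.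
  by rewrite (scaleNr 'i%C (adj B)) opprK scalerDr scalerA mulNr ii opprK scale1r scaleNr addrC.
Qed.

(** The value is kept explicit because [tr] is a [limn] and is informative only once convergence is
    known. *)
Definition has_tr A (z : R[i]) := cvC (fun N => \sum_(n < N) dot (A (e n)) (e n)) z.

Lemma has_trP A (z : R[i]) : has_tr A z -> tr dot e A = z.
Proof.
move=> /cvCP Az; rewrite /tr /series /=.
under [X in limn X]eq_fun do rewrite big_mkord.
exact: cvg_lim Az.
Qed.

(* The ideal of trace class operators, as finite sums of products of two
   Hilbert-Schmidt operators. *)
Inductive nuc : bop H -> Prop :=
| nucM A B : hs A -> hs B -> nuc (A * B)
| nucD A B : nuc A -> nuc B -> nuc (A + B).

Lemma has_tr_hsM A B : hs A -> hs B -> exists z : R[i], has_tr (A * B) z /\ has_tr (B * A) z.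
Proof.
move=> hA hB; have [z [z1 z2]] := hs_pairing hB (hs_adj hA); exists z; split.
  by apply: cvC_ext z1 => N; apply: eq_bigr => i _; rewrite -adjP.
by apply: cvC_ext z2 => N; apply: eq_bigr => i _; rewrite -adjP (adjointK norm_dot onb_e).
Qed.

Lemma has_trD A B (z w : R[i]) : has_tr A z -> has_tr B w -> has_tr (A + B) (z + w).
Proof.
move=> Az Bw; apply: cvC_ext (cvCD Az Bw) => N.
by rewrite -big_split; apply: eq_bigr => i _; rewrite add_bopE dotDl.
Qed.

Lemma has_trZ a A (z : R[i]) : has_tr A z -> has_tr (a *: A) (a * z).
Proof.
move=> Az; apply: cvC_ext (cvCZ a Az) => N.
by rewrite mulr_sumr; apply: eq_bigr => i _; rewrite scale_bopE dotZl.
Qed.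

Lemma nuc_has_tr A : nuc A -> has_tr A (tr dot e A).
Proof.
suff tr_ex : nuc A -> exists z : R[i], has_tr A z.
  by move=> /tr_ex[z Az]; rewrite (has_trP Az).
elim=> {A} [A B hA hB|A B _ [z Az] _ [w Bw]].
  by have [z [z1 _]] := has_tr_hsM hA hB; exists z.
by exists (z + w); exact: has_trD.
Qed.

Lemma trD A B : nuc A -> nuc B -> tr dot e (A + B) = tr dot e A + tr dot e B.
Proof. by move=> /nuc_has_tr At /nuc_has_tr Bt; apply/has_trP/has_trD. Qed.

Lemma trZ a A : nuc A -> tr dot e (a *: A) = a * tr dot e A.
Proof. by move=> /nuc_has_tr At; apply/has_trP/has_trZ. Qed.

Lemma trN A : nuc A -> tr dot e (- A) = - tr dot e A.
Proof. by move=> nA; rewrite -scaleN1r trZ// mulN1r. Qed.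

Lemma nuc_mull A B : nuc A -> nuc (B * A).
Proof.
elim=> [C D hC hD|C D _ nC _ nD]; last by rewrite mulrDr; exact: nucD.
by rewrite mulrA; apply: nucM => //; exact: hs_mull.
Qed.

Lemma nuc_mulr A B : nuc A -> nuc (A * B).
Proof.
elim=> [C D hC hD|C D _ nC _ nD]; last by rewrite mulrDl; exact: nucD.
by rewrite -mulrA; apply: nucM => //; exact: hs_mulr.
Qed.

Lemma nucZ a A : nuc A -> nuc (a *: A).
Proof. by move=> /(nuc_mull (a *: (1 : bop H))); rewrite bop_scalerAl mul1r. Qed.

Lemma nucN A : nuc A -> nuc (- A).
Proof. by rewrite -scaleN1r; exact: nucZ. Qed.

Lemma tr_hsC A B : hs A -> hs B -> tr dot e (A * B) = tr dot e (B * A).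
Proof.
by move=> hA hB; have [z [/has_trP-> /has_trP->]] := has_tr_hsM hA hB.
Qed.

(** For a product [C D] of Hilbert-Schmidt operators, [B] moves by two exchanges of Hilbert-Schmidt
    pairs: from [(B C) D] to [D (B C) = (D B) C], then to [C (D B)]. *)
Lemma tr_mulC A B : nuc A -> tr dot e (B * A) = tr dot e (A * B).
Proof.
elim=> [C D hC hD|C D nC IHC nD IHD].
  rewrite mulrA tr_hsC//; last exact: hs_mull.
  by rewrite mulrA tr_hsC ?mulrA//; exact: hs_mulr.
by rewrite mulrDr mulrDl !trD ?IHC ?IHD//; (exact: nuc_mull || exact: nuc_mulr).
Qed.

End HilbertSchmidt.

(** * Moduli and trace class operators *)

Section SquareRoot.
Context {R : realType} {H : completeNormedModType R[i]}.
Variable dot : {dot H for Num.conj}.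
Hypothesis norm_dot : forall x : H, `|x| ^+ 2 = dot x x.
Variable e : nat -> H.
Hypothesis onb_e : orthonormal_basis dot e.
Implicit Types (A B C D T Y : bop H) (x y z : H).
Local Notation adj := (adjoint dot).
Let adjP := adjointP norm_dot onb_e.
Let adjPr := adjointPr norm_dot onb_e.
Let adjM := adjointM norm_dot onb_e.
Let adjD := adjointD norm_dot onb_e.
Let adjZ := adjointZ norm_dot onb_e.

Lemma quadratic_form0 A : (forall x, dot (A x) x = 0) -> A = 0.
Proof.
move=> A0; apply: bop_ext => x; apply: (dot_eq norm_dot) => y; rewrite [RHS]dot0l.
have ii : 'i%C * 'i%C = -1 :> R[i] by rewrite -expr2 sqr_i.
have ji : Num.conj ('i%C : R[i]) = - 'i%C by simpc.
have := A0 (x + y); have := A0 (x + 'i%C *: y).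
rewrite !bop_atD !bop_atZ !dotDl !dotDr !dotZl !dotZr !A0 ji !mulr0 !addr0 !add0r.
move=> E1 E2.
have E3 : 'i%C * dot (A y) x = 'i%C * dot (A x) y by rewrite -[RHS]addr0 -[X in _ + X]E1; ring.
have E4 : dot (A y) x = dot (A x) y.
  have := congr1 (fun z : R[i] => - 'i%C * z) E3.
  by rewrite !mulrA !mulNr ii !mulN1r !opprK.
by move: E2; rewrite E4 => /eqP; rewrite -mulr2n mulrn_eq0 => /eqP.
Qed.

Lemma dot_adj_mul A x : dot ((adj A * A) x) x = (nrm (A x) ^+ 2)%:C%C.
Proof. by rewrite mul_bopE -adjPr dotxx. Qed.

(** The relation [0 <= z] in [R[i]] forces [z] to be real, so [T] and its adjoint have the same
    quadratic form. *)
Lemma positive_selfadjoint T : positive_op dot T -> adj T = T.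
Proof.
move=> T0; apply/esym/eqP; rewrite -subr_eq0; apply/eqP/quadratic_form0 => x.
rewrite add_bopE opp_bopE dotBl -adjPr (dotC dot x); apply/eqP; rewrite subr_eq0.
have /complex_realP[k ->] : dot (T x) x \is Num.real by rewrite ger0_real.
by rewrite [Num.conj _]conjc_real.
Qed.

Lemma bnd_adj (c : R) A : 0 <= c -> bnd c A -> bnd c (adj A).
Proof.
move=> c0 Ac x; have [->|s0] := eqVneq (nrm (adj A x)) 0; first by rewrite mulr_ge0 ?nrm_ge0.
have sgt0 : 0 < nrm (adj A x) by rewrite lt_def s0 nrm_ge0.
rewrite -(ler_pM2r sgt0) -expr2 (nrm_sqrE norm_dot) -adjP.
rewrite (le_trans (Re_cauchy_schwarz norm_dot _ _))// mulrAC.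
by rewrite ler_wpM2r ?nrm_ge0.
Qed.

Section SquareRootIteration.
Variable B : bop H.
Hypothesis B1 : bnd 1 B.

(* Each approx n is a polynomial in B with nonnegative coefficients, so its
   increments are dominated in norm by those of the scalar iteration B = 1. *)
Fixpoint majorant n : R := if n is m.+1 then 2^-1 * (1 + majorant m * majorant m) else 0.
Fixpoint approx n : bop H :=
  if n is m.+1 then 2^-1%:C%C *: (B + approx m * approx m) else 0.

Lemma majorantS n : majorant n.+1 = 2^-1 * (1 + majorant n * majorant n).
Proof. by []. Qed.

Lemma approxS n : approx n.+1 = 2^-1%:C%C *: (B + approx n * approx n).
Proof. by []. Qed.

Lemma majorant_bounds n : 0 <= majorant n <= 1.
Proof. by elim: n => [|n /andP[IH1 IH2]] /=; nra. Qed.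

Lemma majorant_mono m n : (m <= n)%N -> majorant m <= majorant n.
Proof.
move=> /subnK <-; elim: (n - m)%N => // k /le_trans; apply; rewrite addSn /=.
by have /andP[? ?] := majorant_bounds (k + m); nra.
Qed.

Lemma approx_comm D n : D * B = B * D -> D * approx n = approx n * D.
Proof.
move=> DB; elim: n => [|n IH] /=; first by rewrite mulr0 mul0r.
by rewrite bop_scalerAr bop_scalerAl mulrDr mulrDl DB mulrA IH -mulrA IH mulrA.
Qed.

Lemma approx_commute m n : approx m * approx n = approx n * approx m.
Proof. by apply: approx_comm; apply/esym/approx_comm. Qed.

Lemma approx_bnd n : bnd (majorant n) (approx n).
Proof.
elim: n => [|n IH] /=; first by move=> x; rewrite mul0r nrm0.
have h : cmod (2^-1%:C%C : R[i]) = 2^-1 by rewrite cmod_real ger0_norm// invr_ge0.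
rewrite -[X in X * _]h; apply: bndZ; apply: bndD => //.
by apply: bndM => //; have /andP[] := majorant_bounds n.
Qed.

(** Polynomials in [B] commute, so a difference of squares factors; the next increment is half the
    product of the previous increment and a sum, exactly as for the scalar [majorant]. *)
Lemma approx_step n : bnd (majorant n.+1 - majorant n) (approx n.+1 - approx n).
Proof.
elim: n => [|n IH].
  rewrite !subr0; exact: (approx_bnd 1).
have -> : majorant n.+2 - majorant n.+1 = 2^-1 * ((majorant n.+1 - majorant n) * (majorant n.+1 + majorant n)).
  by have := majorantS n; have := majorantS n.+1; set a := majorant n.+2; set b := majorant n.+1; lra.
have -> : approx n.+2 - approx n.+1 =
    2^-1%:C%C *: ((approx n.+1 - approx n) * (approx n.+1 + approx n)).
  rewrite approxS [X in _ - X = _]approxS -scalerBr; congr (_ *: _).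
  rewrite mulrBl !mulrDr (approx_commute n n.+1) !opprD addrACA subrr add0r.
  by rewrite addrA addrK.
have h : cmod (2^-1%:C%C : R[i]) = 2^-1 by rewrite cmod_real ger0_norm// invr_ge0.
rewrite -[X in X * _]h; apply: bndZ; apply: bndM => //.
  by rewrite subr_ge0 majorant_mono.
by apply: bndD; exact: approx_bnd.
Qed.

Lemma approx_increment m n : (m <= n)%N -> bnd (majorant n - majorant m) (approx n - approx m).
Proof.
move=> /subnK <-; elim: (n - m)%N => [|k IH]; first by move=> x; rewrite !subrr mul0r nrm0.
rewrite -(subrKA (majorant (k + m)) (majorant (k.+1 + m))) -(subrKA (approx (k + m)) (approx (k.+1 + m))).
by apply: bndD => //; rewrite addSn; exact: approx_step.
Qed.

(** The equation for [Y] reads [(1 - Y)^2 = 1 - B], so [1 - Y] is the square root being sought. *)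
Lemma square_root_iteration : exists Y,
  [/\ bnd 1 Y, forall x, cvH (fun n => approx n x) (Y x) &
      Y + Y = B + Y * Y].
Proof.
have [l rl] : exists l : R, majorant @ \oo --> l.
  exists (limn majorant).
  apply: nondecreasing_is_cvgn; first by move=> m n; exact: majorant_mono.
  by exists 1 => _ [n _ <-]; have /andP[] := majorant_bounds n.
have lim x : exists y, cvH (fun n => approx n x) y.
  have tl : (fun n => majorant n * nrm x ^+ 2) @ \oo --> l * nrm x ^+ 2.
    by apply: cvgM => //; exact: cvg_cst.
  apply: (cvH_complete tl) => m n mn; rewrite -mulrBl.
  have := approx_increment mn x; rewrite add_bopE opp_bopE => le.
  have /andP[? ?] := majorant_bounds n; have /andP[? ?] := majorant_bounds m.
  have ? := majorant_mono mn.
  rewrite (@le_trans _ _ (((majorant n - majorant m) * nrm x) ^+ 2))//.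
    by rewrite lerXn2r ?nnegrE ?nrm_ge0// mulr_ge0 ?nrm_ge0 ?subr_ge0.
  rewrite exprMn ler_wpM2r ?sqr_ge0// expr2; nra.
have [f fP] := choice lim.
have approx1 n : bnd 1 (approx n) by apply: bnd_weak (@approx_bnd n); have /andP[] := majorant_bounds n.
have [Y YE] : exists Y : bop H, forall x, Y x = f x.
  apply: (@bop_construct _ _ f 1) => // [a x y|x].
    apply: (cvH_uniq (fP _)).
    rewrite (_ : (fun _ => _) = (fun n => a *: approx n x + approx n y)).
      by apply: cvHD (fP y); exact: cvHZ.
    by apply/funext => n; rewrite bop_atD bop_atZ.
  by apply: cvH_nrm_le (fP x) => n; exact: approx1.
have Ylim x : cvH (fun n => approx n x) (Y x) by rewrite YE.
have Y1 : bnd 1 Y by move=> x; apply: cvH_nrm_le (Ylim x) => n; exact: approx1.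
exists Y; split=> //; apply: bop_ext => x.
have YY : cvH (fun n => (approx n * approx n) x) ((Y * Y) x).
  apply: squeeze0 (cvg0D (Ylim x) (Ylim (Y x))) => n; rewrite nrm_ge0 andTb.
  rewrite !mul_bopE -(subrKA (approx n (Y x))) -bop_atB (le_trans (nrmD _ _))// lerD2r.
  by have := approx1 n (approx n x - Y x); rewrite mul1r.
have YS : cvH (fun n => approx n.+1 x) (Y x).
  by apply/cvHP; rewrite (cvg_shiftS (fun n => approx n x)); exact/cvHP.
have BY : cvH (fun n => 2^-1%:C%C *: (B x + (approx n * approx n) x))
    (2^-1%:C%C *: (B x + (Y * Y) x)).
  apply: cvHZ; apply: cvHD => //.
  by rewrite /cvH subrr nrm0; exact: cvg_cst.
have := cvH_uniq YS BY => YE2.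
rewrite !add_bopE {1 2}YE2 -scalerDl -rmorphD/= (_ : 2^-1 + 2^-1 = 1) ?scale1r//.
by field.
Qed.

Lemma square_root_comm Y D : (forall x, cvH (fun n => approx n x) (Y x)) ->
  D * B = B * D -> D * Y = Y * D.
Proof.
move=> Ylim DB; apply: bop_ext => x; apply: cvH_uniq (Ylim (D x)).
rewrite (_ : (fun _ => _) = (fun n => D (approx n x))); first exact: cvH_op.
by apply/funext => n; rewrite -!mul_bopE approx_comm.
Qed.

Lemma square_root_selfadjoint Y : (forall x, cvH (fun n => approx n x) (Y x)) ->
  adj B = B -> adj Y = Y.
Proof.
move=> Ylim Bsa; apply: (adjoint_eq norm_dot onb_e) => x y.
apply: (cvC_uniq (cvC_dotl norm_dot y (Ylim x))).
apply: cvC_ext (cvC_dotr norm_dot x (Ylim y)) => n.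
suff sa : adj (approx n) = approx n by rewrite adjP sa.
elim: n => [|n IH] /=; first by apply: (adjoint_eq norm_dot onb_e) => *; rewrite [LHS]dot0l [RHS]dot0r.
by rewrite adjZ [Num.conj _]conjc_real adjD adjM IH Bsa.
Qed.

End SquareRootIteration.
End SquareRoot.

(** * Passage between trace class, Hilbert-Schmidt and nuclear operators *)

Section TraceClass.
Context {R : realType} {H : completeNormedModType R[i]}.
Variable dot : {dot H for Num.conj}.
Hypothesis norm_dot : forall x : H, `|x| ^+ 2 = dot x x.
Variable e : nat -> H.
Hypothesis onb_e : orthonormal_basis dot e.
Implicit Types (A B C D T Y : bop H) (x y z : H).
Local Notation adj := (adjoint dot).
Let adjP := adjointP norm_dot onb_e.
Let adjPr := adjointPr norm_dot onb_e.
Let adjM := adjointM norm_dot onb_e.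
Let adjD := adjointD norm_dot onb_e.
Let adjN := adjointN norm_dot onb_e.
Let adjZ := adjointZ norm_dot onb_e.
Let adj1 := adjoint1 norm_dot onb_e.
Let adjK := adjointK norm_dot onb_e.
Let dot_adj_square := dot_adj_mul norm_dot onb_e.

(* The modulus |C| is written c (1 - Y) with Y a selfadjoint contraction, and
   lies in the bicommutant of C^* C. *)
Lemma modulus_exists C : exists (c : R) Y,
  [/\ 0 < c, bnd 1 Y, adj Y = Y,
      (c%:C%C *: (1 - Y)) * (c%:C%C *: (1 - Y)) = adj C * C &
      forall D, D * (adj C * C) = adj C * C * D -> D * Y = Y * D].
Proof.
have [c c0 Cc] := bop_bnd C.
pose Q := adj C * C; pose B := 1 - (c ^- 2)%:C%C *: Q.
have Qsa : adj Q = Q by rewrite adjM adjK.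
have Bsa : adj B = B by rewrite adjD adjN adjZ [Num.conj _]conjc_real adj1 Qsa.
have c2 : 0 < c ^- 2 by rewrite invr_gt0 exprn_gt0.
(* With [k = c^-2], the square [|x - k Q x|^2] equals [|x|^2 + k^2 |Q x|^2 - 2 k |C x|^2]; as
   [|Q x| <= c |C x|], the middle term is at most [k |C x|^2]. *)
have B1 : bnd 1 B.
  move=> x; rewrite mul1r -(@ler_pXn2r _ 2) ?nnegrE ?nrm_ge0//.
  rewrite add_bopE opp_bopE (nrmB_sqr norm_dot) scale_bopE dotC dotZl ReJ ReZ.
  rewrite dot_adj_square nrmZ cmod_real gtr0_norm//.
  have qc : nrm (adj C (C x)) ^+ 2 <= c ^+ 2 * nrm (C x) ^+ 2.
    rewrite -exprMn lerXn2r ?nnegrE ?mulr_ge0 ?nrm_ge0 ?(ltW c0)//.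
    exact: (bnd_adj norm_dot onb_e (ltW c0) Cc).
  have : c ^- 2 * c ^+ 2 = 1 by rewrite mulVf// gt_eqF// exprn_gt0.
  rewrite [complex.Re _]/= [Q x]mul_bopE; move: qc; set q := nrm (adj C (C x)) ^+ 2; set k := c ^- 2; set l := nrm (C x) ^+ 2.
  move=> qc kc; have : 0 <= l by exact: sqr_ge0.
  have : k ^+ 2 * q <= k * l.
    rewrite expr2 -mulrA ler_wpM2l ?(ltW c2)//.
    by rewrite (le_trans (ler_wpM2l (ltW c2) qc))// mulrA kc mul1r.
  have : 0 < k by [].
  rewrite exprMn -/q [(1 : bop H) x]/=; nra.
have [Y [Y1 Ylim YY]] := square_root_iteration B1.
exists c, Y; split=> // [||D DQ].
- exact: (square_root_selfadjoint norm_dot onb_e Ylim Bsa).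
- rewrite bop_scalerAl bop_scalerAr scalerA mulrBl mul1r mulrBr mulr1 opprB addrA.
  have -> : 1 - Y + Y * Y - Y = (c ^- 2)%:C%C *: Q.
    by rewrite addrAC -(addrA 1) -opprD YY opprD addrA subrK /B subKr.
  rewrite scalerA -!rmorphM/= -expr2 mulfV ?scale1r//.
  by rewrite gt_eqF// exprn_gt0.
- apply: (square_root_comm Ylim); rewrite mulrBr mulr1 mulrBl mul1r bop_scalerAr.
  by rewrite bop_scalerAl DQ.
Qed.

Lemma modulus_positive Y (c : R) : 0 < c -> bnd 1 Y -> adj Y = Y ->
  positive_op dot (c%:C%C *: (1 - Y)).
Proof.
move=> c0 Y1 Ysa x; rewrite scale_bopE dotZl mulr_ge0 ?ler0c ?(ltW c0)//.
rewrite add_bopE opp_bopE dotBl (dotxx norm_dot) subr_ge0.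
have real : dot (Y x) x = (complex.Re (dot (Y x) x))%:C%C.
  by apply/esym/RRe_real/CrealP; rewrite -dotC adjPr Ysa.
rewrite real lecR (le_trans (Re_cauchy_schwarz norm_dot _ _))//.
by rewrite expr2 ler_wpM2r ?nrm_ge0// -[X in _ <= X]mul1r.
Qed.

(** Every root [T] is compared with the constructed root [a], which commutes with [T] because [T]
    commutes with [T^2 = C^* C]. Then [D = a - T] satisfies [D (a + T) = 0], so the nonnegative
    forms of [D a D] and [D T D] add up to zero and both operators vanish. Hence [D^3 = 0], and
    [D = 0] as [D] is selfadjoint. *)
Lemma positive_root_unique C T S : positive_op dot T -> positive_op dot S ->
  T * T = adj C * C -> S * S = adj C * C -> T = S.
Proof.
have [c [Y [c0 Y1 Ysa aa Ycomm]]] := modulus_exists C.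
set a := c%:C%C *: (1 - Y) in aa.
have a0 : positive_op dot a by exact: modulus_positive.
suff main T' : positive_op dot T' -> T' * T' = adj C * C -> T' = a.
  by move=> T0 S0 TT SS; rewrite (main T)// (main S).
move=> {T S} {}T0 TT; rename T' into T.
have [D DE] : exists D, D = a - T by exists (a - T).
have aT : a * T = T * a.
  rewrite /a bop_scalerAl bop_scalerAr mulrBl mulrBr mul1r mulr1 -(Ycomm T)//.
  by rewrite -TT mulrA.
have Dsa : adj D = D.
  by rewrite DE adjD adjN !(positive_selfadjoint norm_dot onb_e).
have D0 : D * (a + T) = 0.
  by rewrite DE mulrBl !mulrDr aa -TT aT opprD addrA addrK subrr.
have sum0 x : dot (a (D x)) (D x) + dot (T (D x)) (D x) = 0.
  have E : dot ((D * (a + T)) (D x)) x = 0 by rewrite D0; exact: dot0l.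
  by rewrite -E mul_bopE add_bopE bop_atD dotDl !(adjP D) Dsa.
have z1 x : dot (a (D x)) (D x) = 0.
  have /eqP := sum0 x; rewrite paddr_eq0; [|exact: a0|exact: T0].
  by case/andP => /eqP.
have z2 x : dot (T (D x)) (D x) = 0 by have := sum0 x; rewrite z1 add0r.
have DaD : D * a * D = 0.
  by apply: (quadratic_form0 norm_dot) => x; rewrite !mul_bopE (adjP D) Dsa.
have DTD : D * T * D = 0.
  by apply: (quadratic_form0 norm_dot) => x; rewrite !mul_bopE (adjP D) Dsa.
have D3 : D * D * D = 0 by rewrite {2}DE mulrBr mulrBl DaD DTD subrr.
have sqD y : nrm (D y) ^+ 2 = complex.Re (dot (D (D y)) y).
  by rewrite (nrm_sqrE norm_dot) [in RHS](adjP D) Dsa.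
have DD x : D (D x) = 0.
  apply: nrm_eq0; apply/eqP; rewrite -sqrf_eq0 sqD.
  by rewrite -[D (D (D x))]/((D * D * D) x) D3 [dot _ _]dot0l.
have Dz : D = 0.
  by apply: bop_ext => x; apply: nrm_eq0; apply/eqP; rewrite -sqrf_eq0 sqD DD dot0l.
by apply/esym/eqP; rewrite -subr_eq0 -DE Dz.
Qed.

(** A positive [T] is its own modulus by uniqueness, so the root hidden in [trace_class] is [T]
    itself. Its diagonal entries are nonnegative, hence partial sums stay below the limit. *)
Lemma trace_class_positive_sum T : positive_op dot T -> trace_class dot e T ->
  exists c : R, forall N, \sum_(n < N) complex.Re (dot (T (e n)) (e n)) <= c.
Proof.
move=> T0 [S [S0 SS]].
have Tsa := positive_selfadjoint norm_dot onb_e T0.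
rewrite (@positive_root_unique T S T)//; last by rewrite Tsa.
rewrite /summable_diag /series /=; under eq_fun do rewrite big_mkord.
move=> /cvgP/cvCP.
set z := limn _ => Tz; exists (complex.Re z) => N.
apply: (@le_lim0 _ _ _ N _ _ Tz) => M NM.
set s := \sum_(n < M) _.
apply: (@le_trans _ _ (complex.Re s)).
  rewrite Re_sum -(subnKC NM) big_split_ord/= lerDl; apply: sumr_ge0 => i _.
  by rewrite -ler0c RRe_real ?ger0_real//; exact: T0.
by have := Re_le_cmod (s - z); rewrite ReD ReN; lra.
Qed.

Lemma schatten1_hs A : schatten dot e 1 A -> hs e A.
Proof.
rewrite /schatten expr1 => /trace_class_positive_sum[x|c Ac].
  by rewrite dot_adj_square ler0c sqr_ge0.
exists c => N; rewrite (le_trans _ (Ac N))//; apply: ler_sum => i _.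
by rewrite dot_adj_square.
Qed.

(** With [Q = A^* A] selfadjoint, [Q^2 = Q^* Q] has diagonal entries [|Q e_n|^2]. *)
Lemma schatten2_hs A : schatten dot e 2 A -> hs e (adj A * A).
Proof.
have QQ x : dot (((adj A * A) ^+ 2) x) x = (nrm ((adj A * A) x) ^+ 2)%:C%C.
  by rewrite -dot_adj_square adjM adjK expr2.
rewrite /schatten => /trace_class_positive_sum[x|c Ac].
  by rewrite QQ ler0c sqr_ge0.
by exists c => N; rewrite (le_trans _ (Ac N))//; apply: ler_sum => i _; rewrite QQ.
Qed.

(** The bound is uniform in [V] because the approximate polar factor changes with the precision
    while its norm bound 2 does not. For a product, [<A B e_n, V e_n> = <B e_n, A^* V e_n>] is split
    into half squares; the factor [2 ^+ 2] comes from the norm of [V]. *)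
Lemma nuc_bound A : nuc e A -> exists c : R, forall V, bnd 2 V ->
  forall N, complex.Re (\sum_(n < N) dot (A (e n)) (V (e n))) <= c.
Proof.
elim=> {A} [A B [a Aa] [b Bb]|A B _ [a Aa] _ [b Bb]]; last first.
  exists (a + b) => V V2 N; apply: le_trans (lerD (Aa V V2 N) (Bb V V2 N)).
  by rewrite -ReD -big_split/= le_eqVlt; apply/orP; left; apply/eqP; congr complex.Re;
    apply: eq_bigr => i _; rewrite -dotDl.
exists (2^-1 * (b + 2 ^+ 2 * a)) => V V2 N.
have AV : hsle e (2 ^+ 2 * a) (adj A * V).
  rewrite -[adj A * V]adjK adjM adjK; apply: (hsle_adj norm_dot onb_e).
  by apply: hsle_mull => //; apply: (bnd_adj norm_dot onb_e).
rewrite Re_sum (@le_trans _ _ (2^-1 * (hsq e B N + hsq e (adj A * V) N)))//; last first.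
  by have := Bb N; have := AV N; lra.
rewrite -big_split mulr_sumr; apply: ler_sum => i _.
rewrite mul_bopE adjP -mul_bopE.
have := Re_dot_le_half norm_dot (B (e i)) ((adj A * V) (e i)) => /=; lra.
Qed.

Definition geom Y m := \sum_(k < m) Y ^+ k.

Lemma geomE Y m : (1 - Y) * geom Y m = 1 - Y ^+ m.
Proof.
rewrite /geom; elim: m => [|m IH]; first by rewrite big_ord0 mulr0 expr0 subrr.
by rewrite big_ord_recr mulrDr IH mulrBl mul1r -exprS /= addrA subrK.
Qed.

(** Divided by [m], this provides an approximate inverse of [1 - Y] even when [1 - Y] is not
    invertible: the defect is the mean of the first [m] powers of [Y]. *)
Lemma sum_geomE Y m : (1 - Y) * (\sum_(k < m) geom Y k) = m%:R - geom Y m.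
Proof.
rewrite mulr_sumr; under eq_bigr do rewrite geomE.
by rewrite sumrB big_const_ord iter_addr_0.
Qed.

Lemma bndX Y n : bnd 1 Y -> bnd 1 (Y ^+ n).
Proof.
move=> Y1; elim: n => [|n IH]; first by rewrite expr0; exact: bnd1.
by rewrite exprS -[X in bnd X]mulr1; apply: bndM.
Qed.

Lemma bnd_geom Y m : bnd 1 Y -> bnd m%:R (geom Y m).
Proof.
move=> Y1; rewrite /geom; elim: m => [|m IH].
  by rewrite big_ord0 => x; rewrite mul0r nrm0.
by rewrite big_ord_recr /= -natr1; apply: bndD => //; exact: bndX.
Qed.

(* Polar decomposition up to [1/m]: with |A| = c (1 - Y) and S the mean of the
   first m powers of Y, some V = A q satisfies |A| q = 1 - S, so V is bounded by
   2, while |A| S = c (1 - Y^m) / m. *)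
Lemma approximate_polar A (c : R) Y m : 0 < c -> bnd 1 Y -> adj Y = Y ->
  (c%:C%C *: (1 - Y)) * (c%:C%C *: (1 - Y)) = adj A * A ->
  exists2 V, bnd 2 V & forall x, nrm x = 1 ->
    complex.Re (dot ((c%:C%C *: (1 - Y)) x) x) <=
    complex.Re (dot (A x) (V x)) + 2 * c / m.+1%:R.
Proof.
move=> c0 Y1 Ysa; set a := c%:C%C *: (1 - Y) => aa.
have asa : adj a = a by rewrite adjZ [Num.conj _]conjc_real adjD adjN adj1 Ysa.
pose r : R := m.+1%:R^-1.
have r0 : 0 < r by rewrite invr_gt0 ltr0n.
have mr : m.+1%:R * r = 1 by rewrite mulfV// pnatr_eq0.
pose S := r%:C%C *: geom Y m.+1.
pose q := (c^-1 * r)%:C%C *: (\sum_(k < m.+1) geom Y k).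
have cr : `|r| = r by rewrite gtr0_norm.
have S1 : bnd 1 S.
  rewrite -mr mulrC -{1}cr -cmod_real; apply: bndZ; exact: bnd_geom.
have aq : a * q = 1 - S.
  rewrite /a /q bop_scalerAl bop_scalerAr sum_geomE scalerA -rmorphM/=.
  rewrite mulrA mulfV ?gt_eqF// mul1r scalerBr; congr (_ - _).
  rewrite -scaler_nat scalerA -[RHS]scale1r; congr (_ *: _).
  by rewrite -(rmorph_nat (real_complex R)) -rmorphM/= mulrC mr.
have aS : bnd (2 * c * r) (a * S).
  rewrite /a /S bop_scalerAl bop_scalerAr geomE scalerA -rmorphM/=.
  have -> : 2 * c * r = cmod (c * r)%:C%C * 2.
    by rewrite cmod_real ger0_norm ?mulr_ge0 ?ltW//; ring.
  apply: bndZ; rewrite (_ : 2 = 1 + 1)//; apply: bndD; first exact: bnd1.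
  by apply: bndN; exact: bndX.
(* Since [A^* A = a^2], the operators [A] and [a] give the same inner products, so norms of [A q x]
   can be read off from [a q = 1 - S]. *)
have AA x y : dot (A x) (A y) = dot (a x) (a y) by rewrite (adjPr A) (adjPr a) asa -!mul_bopE -aa.
exists (A * q) => [x|x x1].
  have -> : nrm ((A * q) x) = nrm ((1 - S) x).
    apply/eqP; rewrite -(@eqrXn2 _ 2) ?nrm_ge0// !(nrm_sqrE norm_dot).
    by rewrite mul_bopE AA -!mul_bopE aq.
  rewrite (_ : 2 = 1 + 1)//; apply: bndD; first exact: bnd1.
  exact: bndN.
(* Here [<A x, V x> = <a x, x> - <a x, S x>], and the last term is at most
   [|a S x| <= 2 c / (m + 1)]. *)
rewrite mul_bopE AA -mul_bopE aq add_bopE opp_bopE dotBr ReD ReN.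
have := aS x; rewrite x1 mulr1 => aSx.
have := Re_cauchy_schwarz norm_dot ((a * S) x) x; rewrite x1 mulr1 ReC_dot.
rewrite mul_bopE adjPr asa -/r => ?; lra.
Qed.

Lemma nuc_trace_class A : nuc e A -> trace_class dot e A.
Proof.
move=> /nuc_bound[K KA]; have [c [Y [c0 Y1 Ysa aa _]]] := modulus_exists A.
exists (c%:C%C *: (1 - Y)); set a := _ *: _ in aa *.
have a0 : positive_op dot a by exact: modulus_positive.
split=> //.
have aR n : dot (a (e n)) (e n) = (complex.Re (dot (a (e n)) (e n)))%:C%C.
  by rewrite RRe_real// ger0_real//; exact: a0.
have e1 n : nrm (e n) = 1.
  apply/eqP; rewrite -(@eqrXn2 _ 2) ?nrm_ge0// (nrm_sqrE norm_dot).
  by case: onb_e => -> _; rewrite eqxx expr1n.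
have [||l al] := @bounded_sum_cvg _ (fun n => complex.Re (dot (a (e n)) (e n))) K.
- by move=> n; rewrite -ler0c -aR; exact: a0.
- move=> N.
  (* [N] is fixed while [m] grows: each of the [N] diagonal entries contributes an error
     [2 c / (m + 1)], and [K] is independent of [m]. *)
  apply: (@le_lim0 _ _ _ 0 _ _ (cvg0Z N%:R (cvg0_harmonic (2 * c)))) => m _.
  have [V V2 aV] := approximate_polar m c0 Y1 Ysa aa.
  apply: le_trans (lerD (KA V V2 N) (lexx _)).
  rewrite Re_sum mulr_natl -[X in _ <= _ + _ *+ X]card_ord -sumr_const -big_split.
  by apply: ler_sum => i _; exact: aV.
- rewrite /summable_diag /series /=; under eq_fun do rewrite big_mkord.
  have /cvCP/cvgP : cvC (fun N => \sum_(n < N) dot (a (e n)) (e n)) l%:C%C.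
    by apply: cvC_ext (cvC_real al) => N; rewrite rmorph_sum; apply: eq_bigr => i _; rewrite aR.
  by [].
Qed.

End TraceClass.

(** * The Schatten ideal of exponent four *)

Section SchattenFour.
Context {R : realType} {H : completeNormedModType R[i]}.
Variable dot : {dot H for Num.conj}.
Hypothesis norm_dot : forall x : H, `|x| ^+ 2 = dot x x.
Variable e : nat -> H.
Hypothesis onb_e : orthonormal_basis dot e.
Implicit Types (A B M : bop H).
Local Notation adj := (adjoint dot).
Let adjP := adjointP norm_dot onb_e.
Let adjM := adjointM norm_dot onb_e.
Let adjD := adjointD norm_dot onb_e.
Let adjK := adjointK norm_dot onb_e.

(* The left-hand side is tr (M G) for the finite rank operator
   G = sum_k v_k (x) v_k^*, and the last sum is the squared Hilbert-Schmidt
   norm of G. *)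
Lemma quadratic_sum_le (c : R) M n (v : nat -> H) : hsle e c M ->
  2 * \sum_(k < n) complex.Re (dot (M (v k)) (v k)) <=
  c + \sum_(k < n) \sum_(l < n) cmod (dot (v k) (v l)) ^+ 2.
Proof.
move=> Mc.
pose S N x := \sum_(m < N) dot x (e m) *: e m.
(* The vectors [v k] are truncated in the basis inside [M] and inside one factor of each Gram term,
   which reduces the claim to finite sums in [m]. *)
pose u N := 2%:C%C * (\sum_(k < n) dot (M (S N (v k))) (v k)) +
  (-1) * (\sum_(k < n) \sum_(l < n)
    dot (v k) (v l) * (\sum_(m < N) dot (v l) (e m) * dot (e m) (v k))).
have ulim : cvC u (2%:C%C * (\sum_(k < n) dot (M (v k)) (v k)) +
  (-1) * (\sum_(k < n) \sum_(l < n) dot (v k) (v l) * dot (v l) (v k))).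
  apply: cvCD; apply: cvCZ; apply: cvC_sum => k.
    by apply: (cvC_dotl norm_dot); apply: cvH_op; exact: (expansion_cvH onb_e).
  by apply: cvC_sum => l; apply: cvCZ; exact: (parseval_dot norm_dot onb_e).
suff uc N : complex.Re (u N) <= c.
  have := Re_lim_le ulim uc; rewrite ReD ReZ Re_sum mulN1r ReN Re_sum.
  rewrite lerBlDr => /le_trans; apply; rewrite lerD2l le_eqVlt; apply/orP; left.
  apply/eqP; apply: eq_bigr => k _; rewrite Re_sum; apply: eq_bigr => l _.
  by rewrite (dotC dot (v l)) cmod_sqr.
(* This is [G e_m]. The truncated expression becomes a sum over [m] of
   [2 Re <M e_m, G e_m> - |G e_m|^2], and each term is at most [|M e_m|^2]. *)
pose g m := \sum_(k < n) dot (e m) (v k) *: v k.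
have E1 : \sum_(k < n) dot (M (S N (v k))) (v k) = \sum_(m < N) dot (M (e m)) (g m).
  under eq_bigr do rewrite /S bop_at_sum dot_suml.
  rewrite exchange_big; apply: eq_bigr => m _; rewrite dot_sumr.
  by apply: eq_bigr => k _; rewrite bop_atZ dotZl dotZr -dotC.
have E2 : \sum_(k < n) \sum_(l < n)
    dot (v k) (v l) * (\sum_(m < N) dot (v l) (e m) * dot (e m) (v k)) =
    \sum_(m < N) dot (g m) (g m).
  under eq_bigr do under eq_bigr do rewrite mulr_sumr.
  under eq_bigr do rewrite exchange_big.
  rewrite exchange_big; apply: eq_bigr => m _; rewrite dot_suml.
  apply: eq_bigr => k _; rewrite dot_sumr; apply: eq_bigr => l _.
  by rewrite dotZl dotZr -dotC; ring.
rewrite /u E1 E2 ReD ReZ mulN1r ReN !Re_sum (le_trans _ (Mc N))//.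
rewrite mulr_sumr -sumrB; apply: ler_sum => m _.
by have := Re_dot_le_half norm_dot (M (e m)) (g m); rewrite -(nrm_sqrE norm_dot); lra.
Qed.

(** The Gram entries are the coefficients of [A^* A e_k], so Bessel applies row by row. *)
Lemma gram_le A n : \sum_(k < n) \sum_(l < n) cmod (dot (A (e k)) (A (e l))) ^+ 2 <=
  hsq e (adj A * A) n.
Proof.
apply: ler_sum => k _.
rewrite (le_trans _ (bessel norm_dot onb_e ((adj A * A) (e k)) n))//.
by apply: ler_sum => l _; rewrite mul_bopE -(adjK A) -adjP adjK.
Qed.

(** This is the class B_4: [(A^* A)^2] has finite trace exactly when [A^* A] is Hilbert-Schmidt. *)
Definition hs4 A := hs e (adj A * A).

Lemma hs_hs4 A : hs e A -> hs4 A.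
Proof. exact: hs_mull. Qed.

(** A case of the Hoelder inequality. Taking [M = A^* A] and [v_k = B e_k] in the duality estimate
    makes its left side twice the partial sum for [A B], and the Gram sum is controlled by
    [B^* B]. *)
Lemma hs4_mul A B : hs4 A -> hs4 B -> hs e (A * B).
Proof.
move=> [a Aa] [b Bb]; exists (2^-1 * (a + b)) => n.
have := quadratic_sum_le n (fun k => B (e k)) Aa; have := gram_le B n; have := Bb n.
suff -> : hsq e (A * B) n =
    \sum_(k < n) complex.Re (dot ((adj A * A) (B (e k))) (B (e k))) by lra.
by apply: eq_bigr => k _; rewrite (dot_adj_mul norm_dot onb_e).
Qed.

(* With L the partial sum of |A A^* e_k|^2, the two preceding estimates give
   2 L <= c + L. *)
Lemma hs4_adj A : hs4 A -> hs4 (adj A).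
Proof.
move=> [a Aa]; exists a => n.
have := quadratic_sum_le n (fun k => adj A (e k)) Aa; have := gram_le (adj A) n.
rewrite adjK.
suff -> : hsq e (A * adj A) n =
    \sum_(k < n) complex.Re (dot ((adj A * A) (adj A (e k))) (adj A (e k))) by lra.
by apply: eq_bigr => k _; rewrite (dot_adj_mul norm_dot onb_e).
Qed.

Lemma hs4_mulr A B : hs4 A -> hs4 (A * B).
Proof.
move=> hA; rewrite /hs4 adjM -mulrA; apply: hs_mull; rewrite mulrA.
exact: (hs_mulr norm_dot onb_e).
Qed.

Lemma hs4_mull A B : hs4 A -> hs4 (B * A).
Proof.
by move=> /hs4_adj /(hs4_mulr (adj B)) /hs4_adj; rewrite -adjM adjK.
Qed.

(** The cross terms [A^* B] and [B^* A] are handled by [hs4_mul] together with [hs4_adj]. *)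
Lemma hs4D A B : hs4 A -> hs4 B -> hs4 (A + B).
Proof.
move=> hA hB; rewrite /hs4 adjD mulrDl !mulrDr.
have hD := hsD norm_dot.
by apply: (hD); apply: (hD) => //; apply: hs4_mul => //; exact: hs4_adj.
Qed.

End SchattenFour.

(** * Supercommutators with an even involution *)

Section Grading.
Context {R : realType} {H : completeNormedModType R[i]}.
Implicit Types (A B C D F X Y : bop H).
Variable P : bool -> bop H.
Hypothesis P_sum : P false + P true = 1.
Hypothesis P_idem : forall a, P a * P a = P a.
Local Notation g := (gamma P).
Local Notation sg a := ((-1) ^+ (a : bool) : R[i]).

Lemma halfD A : 2^-1 *: (A + A) = A.
Proof.
rewrite scalerDr -scalerDl (_ : 2^-1 + 2^-1 = 1 :> R[i]) ?scale1r//.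
by field.
Qed.

Lemma half_addB A B : 2^-1 *: (A + B + (A - B)) = A.
Proof. by rewrite addrACA subrr addr0 halfD. Qed.

Lemma half_subB A B : 2^-1 *: (A + B - (A - B)) = B.
Proof. by rewrite opprB addrC addrA subrK halfD. Qed.

Lemma P_orth a : P a * P (~~ a) = 0.
Proof.
have : P a * (P false + P true) = P a by rewrite P_sum mulr1.
rewrite mulrDr; case: a => /=; rewrite P_idem.
  by move/(canRL (addrK _)); rewrite subrr.
by rewrite addrC => /(canRL (addrK _)); rewrite subrr.
Qed.

Lemma gammaK : g * g = 1.
Proof.
rewrite /gamma mulrBl !mulrBr !P_idem (P_orth false) (P_orth true).
by rewrite subr0 sub0r opprK P_sum.
Qed.

Lemma gammaKl A : g * (g * A) = A. Proof. by rewrite mulrA gammaK mul1r. Qed.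
Lemma gammaKr A : A * g * g = A. Proof. by rewrite -mulrA gammaK mulr1. Qed.

(** [part] is the eigenprojection of conjugation by [gamma]; block computations thereby become
    algebra with the involution [gamma]. *)
Lemma partE a X : part P a X = 2^-1 *: (X + sg a *: (g * X * g)).
Proof.
set w := P false * X * P false + P true * X * P true.
set z := P true * X * P false + P false * X * P true.
have XE : X = w + z.
  rewrite -[LHS]mul1r -[LHS]mulr1 -P_sum mulrDl mulrDr !mulrDl.
  by rewrite [X in _ + X = _]addrC addrACA.
have gE : g * X * g = w - z.
  by rewrite /gamma mulrBl mulrBr !mulrBl opprB addrACA -opprD.
rewrite gE [Z in _ *: (Z + _)]XE /part big_bool; case: a => /=.
  by rewrite expr1 scaleN1r half_subB /z addrC.
by rewrite expr0 scale1r half_addB /w addrC.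
Qed.

Lemma part_sum X : part P true X + part P false X = X.
Proof.
by rewrite addrC !partE -scalerDr expr1 scaleN1r expr0 scale1r half_addB.
Qed.

Lemma part_diff X : part P false X - part P true X = g * X * g.
Proof.
by rewrite !partE -scalerBr expr1 scaleN1r expr0 scale1r half_subB.
Qed.

Definition homog a X := g * X = sg a *: (X * g).

Lemma homog_conj a X : homog a X -> g * X * g = sg a *: X.
Proof. by move=> ->; rewrite bop_scalerAl gammaKr. Qed.

Lemma homog_part a X : homog a (part P a X).
Proof.
rewrite /homog partE bop_scalerAl bop_scalerAr scalerA mulrC -scalerA; congr (_ *: _).
rewrite (mulrDr g X) (mulrDl X) bop_scalerAl bop_scalerAr -!mulrA gammaKl gammaK mulr1.
by rewrite scalerDr scalerA -signr_addb addbb scale1r addrC.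
Qed.

Lemma part_homog a X : homog a X -> part P a X = X.
Proof.
by move=> /homog_conj gX; rewrite partE gX scalerA -signr_addb addbb scale1r halfD.
Qed.

Lemma part_homog0 a X : homog a X -> part P (~~ a) X = 0.
Proof.
move=> /homog_conj gX; rewrite partE gX scalerA -signr_addb.
by rewrite (_ : ~~ a (+) a = true) ?expr1 ?scaleN1r ?subrr ?scaler0//; case: a {gX}.
Qed.

(** Summing over the degree of [A]: the even part of [B] meets [A] without sign, the odd part meets
    the even part of [A] minus its odd part, which is [gamma A gamma]. *)
Lemma scommE A B :
  scomm P A B = A * B - part P false B * A - part P true B * (g * A * g).
Proof.
rewrite /scomm; under eq_bigr do rewrite sumrB.
rewrite sumrB exchange_big; set U := \sum_(b : bool) _; set V := \sum_(a : bool) _.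
have -> : U = A * B.
  rewrite /U -{2}(part_sum A) -{2}(part_sum B) mulrDl !mulrDr !big_bool/=.
  by rewrite addrACA.
suff -> : V = part P false B * A + part P true B * (g * A * g) by rewrite opprD addrA.
rewrite /V exchange_big big_bool /= !big_bool /= /ksign /= !expr0 expr1 !scale1r scaleN1r.
rewrite addrC -mulrDr part_sum; congr (_ + _).
by rewrite -part_diff mulrBr addrC.
Qed.

Lemma scommBl A B X : scomm P (A - B) X = scomm P A X - scomm P B X.
Proof.
have gE : g * (A - B) * g = g * A * g - g * B * g by rewrite (mulrBr g) (mulrBl g).
rewrite !scommE gE (mulrBl X) 2!(mulrBr (part P _ X)) !opprD !opprK.
by rewrite [RHS]addrACA [Z in _ = Z + _]addrACA.
Qed.

Lemma scomm_homog a b X Y : homog a X -> homog b Y ->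
  scomm P X Y = X * Y - ksign a b *: (Y * X).
Proof.
move=> hX hY; rewrite scommE (homog_conj hX) /ksign.
have := part_homog hY; have := part_homog0 hY.
case: b {hY} => /= -> ->; rewrite ?mul0r ?subr0 ?bop_scalerAr ?andbT//.
by rewrite andbF expr0 scale1r.
Qed.

Lemma scomm_even A X : homog false A -> scomm P A X = A * X - X * A.
Proof.
move=> /homog_conj; rewrite scale1r => hA; rewrite scommE hA -addrA -opprD -mulrDl.
by rewrite [part P false X + _]addrC part_sum.
Qed.

Lemma scomm_right a F X : homog a X ->
  scomm P F X = F * X - X * (if a then g * F * g else F).
Proof.
move=> hX; rewrite scommE; have := part_homog hX; have := part_homog0 hX.
by case: a {hX} => /= -> ->; rewrite ?mul0r ?subr0.
Qed.

(** * Commutators with an even involution *)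

Section EvenInvolution.
Variable F0 : bop H.
Hypothesis F0_comm : g * F0 = F0 * g.
Hypothesis F0K : F0 * F0 = 1.

Lemma homog_even : homog false F0.
Proof. by rewrite /homog expr0 scale1r. Qed.

Lemma commE X : scomm P F0 X = F0 * X - X * F0.
Proof. exact: scomm_even homog_even. Qed.

Lemma comm_anti X : F0 * scomm P F0 X = - (scomm P F0 X * F0).
Proof.
by rewrite commE mulrBr mulrBl opprB mulrA F0K mul1r -(mulrA X) F0K mulr1 mulrA.
Qed.

Lemma comm_part a X : scomm P F0 (part P a X) = part P a (scomm P F0 X).
Proof.
rewrite !commE !partE bop_scalerAl bop_scalerAr -scalerBr; congr (_ *: _).
have -> : g * (F0 * X - X * F0) * g = F0 * (g * X * g) - g * X * g * F0.
  rewrite (mulrBr g) (mulrBl g) !mulrA F0_comm; congr (_ - _).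
  by rewrite -!mulrA F0_comm.
by rewrite (mulrDr F0 X) (mulrDl X) bop_scalerAl bop_scalerAr opprD addrACA -scalerBr.
Qed.

Lemma anti_mul A B : F0 * A = - (A * F0) -> F0 * B = - (B * F0) ->
  F0 * (A * B) = A * B * F0.
Proof. by move=> hA hB; rewrite (mulrA F0) hA mulNr -(mulrA A F0) hB mulrN opprK mulrA. Qed.

Lemma conj_anti A : F0 * A = - (A * F0) -> F0 * (g * A * g) = - (g * A * g * F0).
Proof.
move=> hA; rewrite !mulrA -F0_comm -(mulrA g) hA mulrN mulNr -!mulrA; congr (- (_ * (_ * _))).
exact/esym/F0_comm.
Qed.

(** Each term of the expanded supercommutator is a product of two operators anticommuting with [F0]:
    parts of a commutator with [F0] are such commutators again, and conjugation by [gamma] preserves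
    anticommutation. *)
Lemma comm_scomm X Y : F0 * scomm P (scomm P F0 X) (scomm P F0 Y) =
  scomm P (scomm P F0 X) (scomm P F0 Y) * F0.
Proof.
have subC A B C : F0 * A = A * F0 -> F0 * B = B * F0 -> F0 * C = C * F0 ->
    F0 * (A - B - C) = (A - B - C) * F0.
  by move=> hA hB hC; rewrite 2!mulrBr 2!mulrBl hA hB hC.
rewrite (scommE (scomm P F0 X)) -!comm_part.
by apply: subC; apply: anti_mul; (exact: comm_anti || exact/conj_anti/comm_anti).
Qed.

(* F^2 = F0^2 = 1 means that D = F - F0 satisfies D F0 + F0 D = - D^2. *)
Lemma conditional_arg F C : F * F = 1 -> F0 * C = C * F0 ->
  (F - F0) * C + F0 * ((F - F0) * C) * F0 = - ((F - F0) * (F - F0)) * (F0 * C).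
Proof.
move=> FF CF0; set D := F - F0.
have FE : F = D + F0 by rewrite subrK.
have -> : - (D * D) = D * F0 + F0 * D.
  move: FF; rewrite FE mulrDl !mulrDr F0K addrA => /eqP.
  rewrite -subr_eq0 addrK -addrA addrC addr_eq0 => /eqP->.
  by [].
rewrite (mulrDl (D * F0)) -!mulrA; congr (_ + _); first by rewrite [F0 * (F0 * C)]mulrA F0K mul1r.
by rewrite -CF0.
Qed.

(** * Two-sided ideals, applied to both [hs] and [hs4] *)

Section Ideal.
Variable J : bop H -> Prop.
Hypothesis JD : forall A B, J A -> J B -> J (A + B).
Hypothesis Jl : forall A B, J A -> J (B * A).
Hypothesis Jr : forall A B, J A -> J (A * B).

Lemma ideal_scale a A : J A -> J (a *: A).
Proof. by move=> /(Jl (a *: (1 : bop H))); rewrite bop_scalerAl mul1r. Qed.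

Lemma ideal_opp A : J A -> J (- A).
Proof. by rewrite -scaleN1r; exact: ideal_scale. Qed.

Lemma ideal_sub A B : J A -> J B -> J (A - B).
Proof. by move=> hA /ideal_opp; exact: JD. Qed.

Lemma ideal_part a A : J A -> J (part P a A).
Proof.
by move=> hA; rewrite partE; apply: ideal_scale; apply: JD => //; apply/ideal_scale/Jr/Jl.
Qed.

Lemma ideal_scomml A X : J A -> J (scomm P A X).
Proof.
by move=> hA; rewrite scommE; apply: ideal_sub; [apply: ideal_sub|];
  do ?[exact: Jr | exact: Jl | exact/Jl/Jr/Jl].
Qed.

Lemma ideal_comm F X : J (F - F0) -> J (scomm P F X) -> J (scomm P F0 X).
Proof.
move=> hD hF; rewrite -(subKr F F0) scommBl.
by apply: ideal_sub => //; exact: ideal_scomml.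
Qed.

Lemma ideal_comm_part F a X : J (F - F0) -> J (scomm P F X) ->
  J (scomm P F0 (part P a X)).
Proof. by move=> hD hF; rewrite comm_part; apply/ideal_part/(ideal_comm hD). Qed.

Lemma ideal_scomm_part F a X : J (F - F0) -> J (scomm P F X) -> J (scomm P F (part P a X)).
Proof.
move=> hD hF; rewrite -(subrK (scomm P F0 (part P a X)) (scomm P F _)) -scommBl.
by apply: JD; [exact: ideal_scomml | exact: ideal_comm_part hF].
Qed.

End Ideal.
End EvenInvolution.
End Grading.

(** * The cocycle *)

Section LieDerivative.
Context {R : realType} {H : completeNormedModType R[i]}.
Variable P : bool -> bop H.

(** The difference quotient of an affine functional equals [v] at every nonzero [t], and the
    punctured neighbourhood excludes [t = 0]. *)
Lemma lie_affine X (m : bop H -> R[i]) F (v : R[i]) :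
  (forall t : R, m (F + t%:C%C *: scomm P F X) = m F + t%:C%C * v) ->
  lie_derivable P X m F /\ lie P X m F = v.
Proof.
move=> mF.
have qv : (lie_quotient P X m F t @[t --> (0 : R)^']) --> (v : R[i]^o).
  apply: cvg_near_cst; near=> t.
  have t0 : t%:C%C != 0 :> R[i].
    by rewrite (inj_eq (@complexI R) t 0); near: t; exact: nbhs_dnbhs_neq.
  by rewrite /lie_quotient mF [_ + _ * _]addrC addrK mulrC mulKf.
by split; [apply/cvg_ex; exists v | exact: cvg_lim qv].
Unshelve. all: by end_near.
Qed.

End LieDerivative.

Section Cocycle.
Context {R : realType} {H : completeNormedModType R[i]}.
Variable dot : {dot H for Num.conj}.
Hypothesis norm_dot : forall x : H, `|x| ^+ 2 = dot x x.
Variable e : nat -> H.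
Hypothesis onb_e : orthonormal_basis dot e.
Variable P : bool -> bop H.
Hypothesis P_sum : P false + P true = 1.
Hypothesis P_idem : forall a, P a * P a = P a.
Variable F0 : bop H.
Hypothesis F0_comm : gamma P * F0 = F0 * gamma P.
Hypothesis F0K : F0 * F0 = 1.
Implicit Types (A B C D F X Y Z W : bop H).
Local Notation g := (gamma P).
Local Notation hs := (hs e).
Local Notation nuc := (nuc e).
Local Notation str := (str dot e P).
Local Notation "'d" := (scomm P F0) (at level 0).
Let gK := gammaK P_sum P_idem.

Lemma strD A B : nuc A -> nuc B -> str (A + B) = str A + str B.
Proof.
by move=> nA nB; rewrite /str mulrDr (trD norm_dot onb_e)//; exact: nuc_mull.
Qed.

Lemma strZ a A : nuc A -> str (a *: A) = a * str A.
Proof. by move=> nA; rewrite /str bop_scalerAr (trZ norm_dot onb_e)//; exact: nuc_mull. Qed.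

Lemma strN A : nuc A -> str (- A) = - str A.
Proof. by move=> nA; rewrite -scaleN1r strZ// mulN1r. Qed.

Lemma strB A B : nuc A -> nuc B -> str (A - B) = str A - str B.
Proof. by move=> nA nB; rewrite strD ?strN//; apply: nucN. Qed.

(** The sign arises from moving [X] past [gamma]; [A] may be of mixed degree, as products containing
    [D] are. *)
Lemma str_mulC a X A : homog P a X -> nuc A -> str (X * A) = (-1) ^+ a * str (A * X).
Proof.
move=> hX nA; rewrite /str mulrA hX bop_scalerAl (trZ norm_dot onb_e); last first.
  by rewrite -mulrA; do 2!apply: nuc_mull.
by rewrite -mulrA (tr_mulC norm_dot onb_e) ?mulrA//; exact: nuc_mull.
Qed.

Lemma str_hsC a A B : homog P a A -> hs A -> hs B -> str (A * B) = (-1) ^+ a * str (B * A).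
Proof.
move=> hA hsA hsB; rewrite /str mulrA hA bop_scalerAl (trZ norm_dot onb_e) -mulrA; last first.
  by apply: nucM => //; exact: hs_mull.
by rewrite (tr_hsC norm_dot onb_e) ?mulrA//; exact: hs_mull.
Qed.

Lemma str_odd A : homog P true A -> nuc A -> str A = 0.
Proof.
move=> hA nA; have : str A = - str A.
  rewrite {1}/str hA scaleN1r (trN norm_dot onb_e); last exact: (nuc_mulr norm_dot onb_e).
  by rewrite -(tr_mulC norm_dot onb_e).
by move/eqP; rewrite -addr_eq0 -mulr2n mulrn_eq0 => /eqP.
Qed.

Lemma homogM a b A B : homog P a A -> homog P b B -> homog P (a (+) b) (A * B).
Proof.
move=> hA hB; rewrite /homog mulrA hA bop_scalerAl -mulrA hB bop_scalerAr scalerA.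
by rewrite -signr_addb mulrA.
Qed.

Lemma homog_d a X : homog P a X -> homog P a ('d X).
Proof.
move=> hX; rewrite -(part_homog P_sum P_idem hX) (comm_part P_sum P_idem F0_comm).
exact: homog_part.
Qed.

(** As [F0] commutes with [gamma] and squares to 1, cyclicity gives [F0 A F0] the supertrace of [A].
    For p = 1 the conditional supertrace is thus an ordinary one. *)
Lemma strc_nuc A : nuc A -> strc dot e P F0 A = str A.
Proof.
move=> nA; rewrite /strc mulrDr (trD norm_dot onb_e); last first.
- by apply: nuc_mull; apply: (nuc_mulr norm_dot onb_e); exact: nuc_mull.
- exact: nuc_mull.
have -> : tr dot e (g * (F0 * A * F0)) = str A.
  rewrite /str mulrA -(tr_mulC norm_dot onb_e); last first.
    by apply: nuc_mull; exact: nuc_mull.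
  by rewrite (mulrA g F0 A) F0_comm !mulrA F0K mul1r.
by rewrite -/(str A); field.
Qed.

Lemma b1_affine Z W F : hs (F - F0) -> hs (scomm P F W) -> hs ('d Z) -> forall t : R,
  b1 dot e P F0 Z (F + t%:C%C *: scomm P F W) =
  b1 dot e P F0 Z F + t%:C%C * (8^-1 * str (scomm P F W * F0 * 'd Z)).
Proof.
move=> hD hW hZ t; rewrite /b1 /b1_arg addrAC 2!mulrDl !bop_scalerAl.
rewrite strD ?strZ; first by ring.
- by apply: nucM => //; exact: (hs_mulr norm_dot onb_e).
- by apply: nucM => //; exact: (hs_mulr norm_dot onb_e).
- by apply: (nucZ); apply: nucM => //; exact: (hs_mulr norm_dot onb_e).
Qed.

Lemma d_leibniz X Y : F0 * (X * Y) - X * Y * F0 = 'd X * Y + X * 'd Y.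
Proof.
by rewrite !(commE P_sum P_idem F0_comm) mulrBl mulrBr !mulrA addrA subrK.
Qed.

Lemma nucB A B : nuc A -> nuc B -> nuc (A - B).
Proof. by move=> nA nB; apply: nucD => //; exact: nucN. Qed.

(** Since [F0] is even, the commutator with it is an ungraded derivation, and the sign [k] enters
    only as a scalar. *)
Lemma d_scomm (k : R[i]) X Y : 'd (X * Y - k *: (Y * X)) =
  'd X * Y + X * 'd Y - k *: ('d Y * X + Y * 'd X).
Proof.
rewrite -!d_leibniz (commE P_sum P_idem F0_comm) mulrBr mulrBl bop_scalerAl bop_scalerAr.
by rewrite opprD opprK addrACA scalerBr opprB [Z in _ + Z = _]addrC.
Qed.

(** Moving [X] to the far right costs [(-1)^a]. For odd [X] the remaining conjugation of [D] by
    [gamma] is shifted onto [F0 A X], of degree [b + 1], and the two signs multiply to [(-1)^b],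
    which is [ksign a b]. *)
Lemma str_scomm_right a b D X A : homog P a X -> homog P b A -> hs D -> hs A ->
  str ((D * X - X * (if a then g * D * g else D)) * F0 * A) =
  str (D * (X * F0 * A)) - ksign a b * str (D * F0 * (A * X)).
Proof.
move=> hX hA hD hsA.
have hs_l := @hs_mull _ _ e; have hs_r := @hs_mulr _ _ _ norm_dot _ onb_e.
have nl := @nuc_mull _ _ e; have nr := @nuc_mulr _ _ _ norm_dot _ onb_e.
set Da := if a then _ else _.
have hDa : hs Da by rewrite /Da; case: (a) => //; apply: hs_r; exact: hs_l.
have nF : nuc (Da * (F0 * A)) by apply: nucM => //; exact: hs_l.
have -> : (D * X - X * Da) * F0 * A = D * (X * F0 * A) - X * (Da * (F0 * A)).
  by rewrite -(mulrA _ F0) (mulrBl (F0 * A)) -!mulrA.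
rewrite strB; [|by apply: nucM => //; exact: hs_l|exact: nl].
congr (_ - _); rewrite (str_mulC hX nF) /Da.
case: a hX {nF hDa Da} => hX; last by rewrite /ksign expr0 !mul1r !mulrA.
have hB : homog P (false (+) (b (+) true)) (F0 * (A * X)).
  by apply: homogM; [exact: homog_even | exact: homogM].
have nD : nuc (D * (F0 * (A * X))) by apply: nucM => //; apply: hs_l; exact: hs_r.
have -> : str (g * D * g * (F0 * A) * X) =
    (-1) ^+ (b (+) true) * str (D * (F0 * (A * X))).
  rewrite /str; have -> : g * (g * D * g * (F0 * A) * X) = D * (g * (F0 * (A * X))).
    by rewrite !mulrA gK mul1r.
  rewrite hB bop_scalerAr (mulrA D) (trZ norm_dot onb_e); last exact: nr.
  by rewrite -(tr_mulC norm_dot onb_e).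
rewrite !mulrA; case: (b) => /=; rewrite /ksign /=; ring.
Qed.

Lemma cocycle_homog a b F X Y : homog P a X -> homog P b Y ->
  hs (F - F0) -> hs ('d X) -> hs ('d Y) -> hs (scomm P F X) -> hs (scomm P F Y) ->
  c1 dot e P F0 X Y + delta_homogeneous P (b1 dot e P F0) a b X Y F =
  8^-1 * str ((F - F0) * ('d X * 'd Y - ksign a b *: ('d Y * 'd X))).
Proof.
move=> hX hY hD hx hy hFX hFY; rewrite /delta_homogeneous.
have [_ ->] := lie_affine (b1_affine hD hFX hy).
have [_ ->] := lie_affine (b1_affine hD hFY hx).
rewrite /c1 /c1_arg /b1 /b1_arg (scomm_homog P_sum P_idem hX hY) d_scomm.
have hs_l := @hs_mull _ _ e; have hs_r := @hs_mulr _ _ _ norm_dot _ onb_e.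
have hdX := homog_d hX; have hdY := homog_d hY.
have FE c Z : homog P c Z ->
    scomm P F Z = 'd Z + ((F - F0) * Z - Z * (if c then g * (F - F0) * g else F - F0)).
  move=> hZ; rewrite -(scomm_right P_sum P_idem _ hZ) (scommBl P_sum).
  by rewrite addrC subrK.
rewrite (FE a X hX) (FE b Y hY) {FE hFX hFY}.
have dX := commE P_sum P_idem F0_comm X; have dY := commE P_sum P_idem F0_comm Y.
have antiX := comm_anti P_sum P_idem F0_comm F0K X.
move: (F - F0) ('d X) ('d Y) hD hx hy hdX hdY dX dY antiX
  => D x y hD hx hy hdX hdY dX dY antiX.
set k : R[i] := ksign a b.
have nFxy : nuc (F0 * x * y) by apply: nucM => //; exact: hs_l.
have nyFx : nuc (y * F0 * x) by apply: nucM => //; exact: hs_r.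
have nDxY : nuc (D * F0 * (x * Y)) by apply: nucM; exact: hs_r.
have nDXy : nuc (D * F0 * (X * y)) by apply: nucM; [exact: hs_r | exact: hs_l].
have nDyX : nuc (D * F0 * (y * X)) by apply: nucM; exact: hs_r.
have nDYx : nuc (D * F0 * (Y * x)) by apply: nucM; [exact: hs_r | exact: hs_l].
have nDXFy : nuc (D * (X * F0 * y)) by apply: nucM => //; exact: hs_l.
have nDYFx : nuc (D * (Y * F0 * x)) by apply: nucM => //; exact: hs_l.
have E1 : str (D * F0 * (x * Y + X * y - k *: (y * X + Y * x))) =
    str (D * F0 * (x * Y)) + str (D * F0 * (X * y)) -
    k * (str (D * F0 * (y * X)) + str (D * F0 * (Y * x))).
  rewrite mulrBr bop_scalerAr !(mulrDr (D * F0)) strB ?strZ ?strD//; first exact: nucD.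
    exact: nucD.
  by apply: nucZ; exact: nucD.
have hs_right c Z : hs (D * Z - Z * (if c : bool then g * D * g else D)).
  apply: hsB => //; first exact: hs_r.
  by apply: hs_l; case: c => //; apply: hs_r; exact: hs_mull.
have E2 : str ((x + (D * X - X * (if a then g * D * g else D))) * F0 * y) =
    - str (F0 * x * y) + (str (D * (X * F0 * y)) - k * str (D * F0 * (y * X))).
  rewrite (mulrDl x) (mulrDl (x * F0)) strD ?(str_scomm_right hX hdY)//.
  - by rewrite -strN// antiX mulNr opprK.
  - by apply: nucM => //; exact: hs_r.
  - by apply: nucM => //; exact: hs_r.
have E3 : str ((y + (D * Y - Y * (if b then g * D * g else D))) * F0 * x) =
    str (y * F0 * x) + (str (D * (Y * F0 * x)) - k * str (D * F0 * (x * Y))).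
  rewrite (mulrDl y) (mulrDl (y * F0)) strD ?(str_scomm_right hY hdX)//.
    by rewrite /k /ksign andbC.
  by apply: nucM => //; exact: hs_r.
(* The exchange gives [(-1)^b], which differs from [k] only for even [X] and odd [Y]; then [F0 x y]
   is odd and its supertrace vanishes. *)
have E4 : k * str (y * F0 * x) = str (F0 * x * y).
  rewrite -mulrA (str_hsC hdY) //; last exact: hs_l.
  rewrite mulrA /k /ksign; case: (b) hdY => hyb; last by rewrite andbF expr0 !mul1r.
  case: (a) hdX => hxa; first by rewrite /= expr1; ring.
  rewrite (@str_odd (F0 * x * y)) ?mulr0//.
  by apply: (@homogM (false (+) false) true) => //; apply: homogM => //; exact: homog_even.
(* Only the first factor of each product is opened as a commutator with [F0], which produces the
   supertraces already present in [E1], [E2] and [E3]. *)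
have E5 : str (D * (x * y - k *: (y * x))) =
    (str (D * F0 * (X * y)) - str (D * (X * F0 * y))) -
    k * (str (D * F0 * (Y * x)) - str (D * (Y * F0 * x))).
  have -> : x * y - k *: (y * x) = (F0 * X * y - X * F0 * y) - k *: (F0 * Y * x - Y * F0 * x).
    by rewrite {1}dX {2}dY !mulrBl.
  have DE Z z : D * (F0 * Z * z - Z * F0 * z) = D * F0 * (Z * z) - D * (Z * F0 * z).
    by rewrite (mulrBr D) !mulrA.
  rewrite (mulrBr D) bop_scalerAr !DE strB ?strZ ?strB//; first exact: nucB.
  - exact: nucB.
  - by apply: nucZ; exact: nucB.
rewrite E1 E2 E3 E5.
(* With [k^2 = 1] the terms in [D F0 x Y] and [D F0 y X] cancel between [E1] and the two Lie
   derivatives. By [E4] these derivatives also contribute two equal copies of [str(F0 x y) / 8],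
   which cancel the [1/4] of [c1]. *)
have kk : k * k = 1 by rewrite /k /ksign -signr_addb addbb.
have q4 : 4^-1 = 2 * 8^-1 :> R[i] by field.
rewrite q4; ring: kk E4.
Qed.

End Cocycle.

(** * Existence of the conditional supertrace, and reduction to homogeneous arguments *)

Section Existence.
Context {R : realType} {H : completeNormedModType R[i]}.
Variable dot : {dot H for Num.conj}.
Hypothesis norm_dot : forall x : H, `|x| ^+ 2 = dot x x.
Variable e : nat -> H.
Hypothesis onb_e : orthonormal_basis dot e.
Variable P : bool -> bop H.
Hypothesis P_sum : P false + P true = 1.
Hypothesis P_idem : forall a, P a * P a = P a.
Variable F0 : bop H.
Hypothesis F0_comm : gamma P * F0 = F0 * gamma P.
Hypothesis F0K : F0 * F0 = 1.
Implicit Types (A F X Y : bop H).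
Local Notation hs := (hs e).
Local Notation nuc := (nuc e).
Local Notation hs4 := (hs4 dot e).
Local Notation str := (str dot e P).

Lemma nuc_conditional F X Y : F * F = 1 -> hs4 (F - F0) ->
  hs4 (scomm P F0 X) -> hs4 (scomm P F0 Y) ->
  nuc (rhs_arg P F0 X Y F + F0 * rhs_arg P F0 X Y F * F0).
Proof.
move=> FF hD hx hy; rewrite /rhs_arg conditional_arg//; last exact: comm_scomm.
have J4D := hs4D norm_dot onb_e; have J4l := hs4_mull norm_dot onb_e.
have J4r := hs4_mulr norm_dot onb_e; have mul4 := hs4_mul norm_dot onb_e.
apply: nucM; first by apply: (hsN); exact: mul4.
apply: hs_mull; rewrite scommE//; apply: (hsB norm_dot); first apply: (hsB norm_dot).
- exact: mul4.
- by apply: mul4 => //; apply: (ideal_part P_sum J4D J4l J4r).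
- apply: mul4; first by apply: (ideal_part P_sum J4D J4l J4r).
  by apply: J4r; exact: J4l.
Qed.

Lemma str_sum (A : bool -> bop H) : (forall a, nuc (A a)) ->
  str (\sum_(a : bool) A a) = \sum_(a : bool) str (A a).
Proof. by move=> nA; rewrite !big_bool (strD norm_dot onb_e). Qed.

Lemma nuc_sum (A : bool -> bop H) : (forall a, nuc (A a)) -> nuc (\sum_(a : bool) A a).
Proof. by move=> nA; rewrite big_bool; exact: nucD. Qed.

(** [delta] and the outer supercommutator are sums over homogeneous parts by definition. Only [c1]
    has to be split by hand, and this relies on each of its pieces having a trace. *)
Lemma cocycle_formula F X Y : hs (F - F0) -> hs (scomm P F X) -> hs (scomm P F Y) ->
  c2 dot e P F0 X Y F = 8^-1 * strc dot e P F0 (rhs_arg P F0 X Y F).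
Proof.
move=> hD hFX hFY.
have JD := hsD norm_dot (e := e); have Jl := @hs_mull _ _ e.
have Jr := hs_mulr norm_dot onb_e.
have hx a : hs (scomm P F0 (part P a X)).
  exact: (ideal_comm_part P_sum P_idem F0_comm JD Jl Jr _ hD hFX).
have hy a : hs (scomm P F0 (part P a Y)).
  exact: (ideal_comm_part P_sum P_idem F0_comm JD Jl Jr _ hD hFY).
have hFXa a : hs (scomm P F (part P a X)).
  exact: (ideal_scomm_part P_sum P_idem F0_comm JD Jl Jr _ hD hFX).
have hFYa a : hs (scomm P F (part P a Y)).
  exact: (ideal_scomm_part P_sum P_idem F0_comm JD Jl Jr _ hD hFY).
pose T a b := scomm P F0 (part P a X) * scomm P F0 (part P b Y) -
  ksign a b *: (scomm P F0 (part P b Y) * scomm P F0 (part P a X)).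
have nT a b : nuc ((F - F0) * T a b).
  by apply: nuc_mull; apply: nucB; [exact: nucM | apply: nucZ; exact: nucM].
have rhsE : rhs_arg P F0 X Y F = \sum_(a : bool) \sum_(b : bool) (F - F0) * T a b.
  rewrite /rhs_arg /scomm mulr_sumr; apply: eq_bigr => a _; rewrite mulr_sumr.
  by apply: eq_bigr => b _; rewrite /T !comm_part.
have c1E : c1 dot e P F0 X Y =
    \sum_(a : bool) \sum_(b : bool) c1 dot e P F0 (part P a X) (part P b Y).
  have nc a b : nuc (c1_arg P F0 (part P a X) (part P b Y)).
    by apply: nucM => //; exact: hs_mull.
  rewrite /c1; under eq_bigr do rewrite -mulr_sumr -str_sum//.
  rewrite -mulr_sumr -str_sum; last by move=> a; apply: nuc_sum.
  congr (_ * str _); rewrite !big_bool /= /c1_arg -!mulrDr -!mulrDl -mulrDr.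
  by rewrite !(comm_part P_sum P_idem F0_comm) !part_sum.
rewrite /c2 c1E /delta -big_split rhsE strc_nuc//; last first.
  by apply: nuc_sum => a; exact: nuc_sum.
rewrite str_sum; last by move=> a; exact: nuc_sum.
rewrite mulr_sumr; apply: eq_bigr => a _; rewrite -big_split str_sum// mulr_sumr.
by apply: eq_bigr => b _; apply: cocycle_homog => //; exact: homog_part.
Qed.

End Existence.

Theorem theorem1 (R : realType) (H : completeNormedModType R[i])
    (dot : {dot H for Num.conj})
    (norm_dot : forall x : H, `|x| ^+ 2 = dot x x)
    (sepH : separable H)
    (e : nat -> H) (onb_e : orthonormal_basis dot e)
    (P : bool -> bop H) (gradP : grading dot P)
    (infP : forall a : bool, ~ finite_dimensional (range (P a)))
    (F0 : bop H)
    (F0_even : F0 * gamma P - gamma P * F0 = 0)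
    (F0_sa : adjoint dot F0 = F0)
    (F0_inv : F0 * F0 = 1) :
  (forall F X Y : bop H,
    Gr dot e F0 1 F -> gp dot e P 1 F X -> gp dot e P 1 F Y ->
    [/\ trace_class dot e (c1_arg P F0 X Y),
        (forall Z G : bop H, gp dot e P 1 F Z -> schatten dot e 1 (G - F0) ->
           trace_class dot e (b1_arg P F0 Z G)),
        (forall Z W : bop H, gp dot e P 1 F Z -> gp dot e P 1 F W ->
           lie_derivable P W (b1 dot e P F0 Z) F),
        strc_defined dot e F0 (rhs_arg P F0 X Y F) &
        c2 dot e P F0 X Y F = 8^-1 * strc dot e P F0 (rhs_arg P F0 X Y F)]) /\
  (forall F X Y : bop H,
    Gr dot e F0 2 F -> gp dot e P 2 F X -> gp dot e P 2 F Y ->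
    strc_defined dot e F0 (rhs_arg P F0 X Y F)).
Proof.
have [P_sum P_idem _] := gradP.
have F0_comm : gamma P * F0 = F0 * gamma P by apply/esym/subr0_eq.
have nuc_tc := nuc_trace_class norm_dot onb_e.
have Jr := hs_mulr norm_dot onb_e.
split=> F X Y [FF FD] FX FY.
  have hs1 := schatten1_hs norm_dot onb_e.
  have hD := hs1 _ FD; have hX := hs1 _ FX; have hY := hs1 _ FY.
  have hd Z : gp dot e P 1 F Z -> hs e (scomm P F0 Z).
    move=> /hs1.
    exact: (ideal_comm P_sum (hsD norm_dot (e := e)) (@hs_mull _ _ e) Jr hD).
  split.
  - by apply: nuc_tc; apply: nucM; [exact/hs_mull/hd | exact: hd].
  - move=> Z G /hd hZ /hs1 hG; apply: nuc_tc.
    by apply: nucM => //; exact: Jr.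
  - move=> Z W /hd hZ /hs1 hW.
    by have [] := lie_affine (b1_affine norm_dot onb_e hD hW hZ).
  (* Hilbert-Schmidt operators lie in B_4, so existence for p = 1 follows from the argument for p =
     2. *)
  - by apply: nuc_tc; apply: nuc_conditional => //; apply: hs_hs4 => //; exact: hd.
  - exact: cocycle_formula.
apply: nuc_tc.
have hs2 A : schatten dot e 2 A -> hs4 dot e A by exact: schatten2_hs.
have hD := hs2 _ FD.
have hd Z : gp dot e P 2 F Z -> hs4 dot e (scomm P F0 Z).
  move=> /hs2; exact: (ideal_comm P_sum (hs4D norm_dot onb_e)
    (hs4_mull norm_dot onb_e) (hs4_mulr norm_dot onb_e) hD).
by apply: nuc_conditional => //; exact: hd.
Qed.
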